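(* Let $k,t$ be positive integers and let $n\geq 111t^3k^3$. If $G$ is a connected graph with $n$ vertices and at most $n\left(1+\frac{1}{127t^2k^2+79t^2k}\right)$ edges, then $r(G,tB_k)=2n+t-2$.
   Context: For graphs $G,H$, the Ramsey number $r(G,H)$ is the smallest positive integer $N$ such that every red-blue coloring of the edges of the complete graph $K_N$ contains a red subgraph isomorphic to $G$ or a blue subgraph isomorphic to $H$. The book $B_k$ is the graph $K_2+\overline{K}_k$ on $k+2$ vertices (an edge together with $k$ further vertices each adjacent to both endpoints of the edge), and $tB_k$ denotes the disjoint union of $t$ vertex-disjoint copies of $B_k$. All graphs are finite and simple. *)

(* Defs.v *)
From HB Require Import structures.
From mathcomp Require Import all_boot all_order all_algebra.
Set Implicit Arguments.
Unset Strict Implicit.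
Unset Printing Implicit Defensive.

Record sgraph (V : finType) := SGraph {
  adj :> rel V;
  adj_sym : symmetric adj;
  adj_irr : irreflexive adj
}.

Definition edges (V : finType) (G : sgraph V) : {set {set V}} :=
  [set [set p.1; p.2] | p : V * V & adj G p.1 p.2].

Definition connected (V : finType) (G : sgraph V) : Prop :=
  0 < #|V| /\ forall x y : V, connect (adj G) x y.

(* G is isomorphic to a (not necessarily induced) subgraph of H. *)
Definition contains_copy (V W : finType) (G : sgraph V) (H : sgraph W) : Prop :=
  exists f : V -> W, injective f /\ forall x y, adj G x y -> adj H (f x) (f y).

Section Constructions.
Variables V W : finType.

Definition complete_rel : rel V := [rel x y | x != y].
Lemma complete_sym : symmetric complete_rel.
Proof. by move=> x y; rewrite /complete_rel /= eq_sym. Qed.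
Lemma complete_irr : irreflexive complete_rel.
Proof. by move=> x; rewrite /complete_rel /= eqxx. Qed.
Definition complete : sgraph V := SGraph complete_sym complete_irr.

Definition compl_rel (G : sgraph V) : rel V :=
  [rel x y | (x != y) && ~~ adj G x y].
Lemma compl_sym (G : sgraph V) : symmetric (compl_rel G).
Proof. by move=> x y; rewrite /compl_rel /= eq_sym adj_sym. Qed.
Lemma compl_irr (G : sgraph V) : irreflexive (compl_rel G).
Proof. by move=> x; rewrite /compl_rel /= eqxx. Qed.
Definition compl (G : sgraph V) : sgraph V :=
  SGraph (compl_sym G) (compl_irr G).

Definition join_rel (G : sgraph V) (H : sgraph W) : rel (V + W) :=
  fun a b => match a, b with
             | inl x, inl y => adj G x y
             | inr x, inr y => adj H x y
             | _, _ => true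
             end.
Lemma join_sym (G : sgraph V) (H : sgraph W) : symmetric (join_rel G H).
Proof. by case=> x [] y //=; rewrite adj_sym. Qed.
Lemma join_irr (G : sgraph V) (H : sgraph W) : irreflexive (join_rel G H).
Proof. by case=> x /=; rewrite adj_irr. Qed.
Definition join (G : sgraph V) (H : sgraph W) : sgraph (V + W)%type :=
  SGraph (join_sym G H) (join_irr G H).

Definition copies_rel (t : nat) (G : sgraph V) : rel ('I_t * V) :=
  [rel a b | (a.1 == b.1) && adj G a.2 b.2].
Lemma copies_sym (t : nat) (G : sgraph V) : symmetric (@copies_rel t G).
Proof. by move=> a b; rewrite /copies_rel /= eq_sym adj_sym. Qed.
Lemma copies_irr (t : nat) (G : sgraph V) : irreflexive (@copies_rel t G).
Proof. by move=> a; rewrite /copies_rel /= adj_irr andbF. Qed.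
Definition copies (t : nat) (G : sgraph V) : sgraph ('I_t * V)%type :=
  SGraph (@copies_sym t G) (@copies_irr t G).

(* An edge colouring is a function c of the unordered pair [set x; y]; its
   values on sets that are not edges of the complete graph play no role. *)
Definition color_rel (c : {set V} -> bool) (b : bool) : rel V :=
  [rel x y | (x != y) && (c [set x; y] == b)].
Lemma color_sym c b : symmetric (color_rel c b).
Proof. by move=> x y; rewrite /color_rel /= eq_sym setUC. Qed.
Lemma color_irr c b : irreflexive (color_rel c b).
Proof. by move=> x; rewrite /color_rel /= eqxx. Qed.
Definition color_class (c : {set V} -> bool) (b : bool) : sgraph V :=
  SGraph (color_sym c b) (color_irr c b).

End Constructions.

Definition book (k : nat) : sgraph ('I_2 + 'I_k)%type :=
  join (complete 'I_2) (compl (complete 'I_k)).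

(* Red is true, blue is false. *)
Definition arrows (V W : finType) (N : nat) (G : sgraph V) (H : sgraph W) :
    Prop :=
  forall c : {set 'I_N} -> bool,
    contains_copy G (color_class c true) \/
    contains_copy H (color_class c false).

(* r(G, H) = N.  Taken as a relation, so that the equation also asserts that
   the minimum exists. *)
Definition ramsey_number_is (V W : finType) (G : sgraph V) (H : sgraph W)
    (N : nat) : Prop :=
  [/\ 0 < N, arrows N G H &
      forall M : nat, 0 < M -> arrows M G H -> N <= M].

(* Main.v *)
Require Import Defs.
From HB Require Import structures.
From mathcomp Require Import all_boot all_order all_algebra.
From mathcomp Require Import zify.
From Stdlib Require Import Classical.
Set Implicit Arguments.
Unset Strict Implicit.
Unset Printing Implicit Defensive.

(** Two disjoint red cliques on [n - 1] vertices and [t - 1] further vertices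
    joined to everything in blue give the lower bound.

    For the upper bound, suppose that a colouring on [2n + t - 2] vertices has no
    blue [t B_k].  Fewer than [t] vertices have blue degree at least [n + c], for
    a small constant [c]: the blue neighbourhood of such a vertex would otherwise
    contain blue stars K_{1,k} robustly, or be so close to a red clique that it
    contains [G].  Among the other vertices every connected graph as sparse as
    [G] with at most [n - c] vertices embeds in red: leaves are attached greedily,
    suspended paths (interior vertices of degree 2) are shortened, and what
    remains is small.  It is then enough to delete a few vertices of [G] whose
    reinsertion can be forced.  Since [G] is sparse, it has a long suspended path,
    or many leaves with distinct neighbours, or many leaves at one vertex.
    - If a red path cannot be lengthened through a free vertex, the successors of
      the red neighbours of that vertex form a blue clique; so free vertices are
      blue to most of the path, and span no [t] disjoint blue edges.
    - If the leaves cannot be matched, Hall's theorem yields a large blue complete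
      bipartite graph, again with no [t] disjoint blue edges on its large side.
    - If the leaves at one vertex cannot be attached, the colouring is nearly two
      red cliques joined in blue, and a degree count produces [t] blue books. *)

(** * Hall's theorem and degree sums *)

Section Hall.
Variables (I S : finType).

Definition related (r : I -> S -> bool) (B : {set I}) : {set S} :=
  [set s | [exists i in B, r i s]].

(** Induction on [#|A|]. If a nonempty proper subset [B] of [A] is tight, [B] and [A :\: B] are
    matched separately. Otherwise every nonempty proper subset has a spare partner, so one element
    may receive any of its partners. The value [s0] serves when [A] is empty. *)
Lemma hall (s0 : S) (A : {set I}) (r : I -> S -> bool) :
  (forall B : {set I}, B \subset A -> #|B| <= #|related r B|) ->
  exists g : I -> S, {in A &, injective g} /\ {in A, forall i, r i (g i)}.
Proof.
have [m] := ubnP #|A|; elim: m => // m IH in A r *; rewrite ltnS => leAm hallA.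
have relP (r' : I -> S -> bool) (B : {set I}) s :
    reflect (exists2 i, i \in B & r' i s) (s \in related r' B).
  by rewrite inE; apply: exists_inP.
case: (set_0Vmem A) => [-> | [i iA]].
  by exists (fun=> s0); split=> [? ?|?]; rewrite inE.
case: (boolP [exists B : {set I}, [&& B \subset A, B != set0, B != A &
                  #|related r B| <= #|B|]]).
- case/existsP=> B /and4P[BA B0 BnA tight].
  have BpA : B \proper A by rewrite properEneq BnA.
  have [|C CB|g [injg rg]] := IH B r.
  + by apply: leq_trans (proper_card BpA) leAm.
  + by apply: hallA; apply: subset_trans CB BA.
  (* The partners of [B] are withdrawn; Hall's condition for [C] outside [B] then follows from the
     one for [B :|: C]. *)
  pose r' j s := r j s && (s \notin related r B).
  have [||g' [injg' rg']] := IH (A :\: B) r'.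
  + have := cardsID B A; have := card_gt0 B; rewrite (setIidPr BA) B0; lia.
  + move=> C CAB; have := hallA (B :|: C).
    rewrite subUset BA (subset_trans CAB) ?subsetDl // => /(_ isT).
    have dBC : B :&: C = set0.
      apply/eqP; rewrite setI_eq0 disjoint_sym.
      by move: CAB; rewrite subsetD => /andP[].
    have := cardsUI B C; rewrite dBC cards0 addn0 => ->.
    suff : related r (B :|: C) \subset related r B :|: related r' C.
      by move/subset_leq_card; have := cardsU (related r B) (related r' C); lia.
    apply/subsetP=> s /relP[j]; rewrite in_setU.
    case/orP=> jB rjs; rewrite in_setU.
      by apply/orP; left; apply/relP; exists j.
    case: (boolP (s \in related r B)) => //= sB.
    by apply/relP; exists j; rewrite // /r' rjs.
  exists (fun j => if j \in B then g j else g' j); split=> [a b aA bA|a aA] /=.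
    have in_rel j : j \in B -> g j \in related r B.
      by move=> jB; apply/relP; exists j; rewrite ?rg.
    have nin_rel j : j \in A -> j \notin B -> g' j \notin related r B.
      by move=> jA jB; have := rg' j; rewrite inE jA jB => /(_ isT) /andP[].
    case: ifP => aB; case: ifP => bB gab.
    + exact: injg.
    + by have := nin_rel _ bA (negbT bB); rewrite -gab in_rel.
    + by have := nin_rel _ aA (negbT aB); rewrite gab in_rel.
    + by apply: injg' => //; rewrite inE ?aA ?bA ?aB ?bB.
  case: ifP => aB; first exact: rg.
  by have := rg' a; rewrite inE aA aB => /(_ isT) /andP[].
- move=> /existsPn noB.
  have [s /relP[i' /set1P-> ris]] : exists s, s \in related r [set i].
    apply/set0Pn; rewrite -card_gt0; apply: leq_trans (hallA _ _).
      by rewrite cards1.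
    by rewrite sub1set.
  pose r' j u := r j u && (u != s).
  have [||g [injg rg]] := IH (A :\ i) r'.
  + by move: leAm; rewrite (cardsD1 i A) iA; lia.
  + move=> C CA; case: (eqVneq C set0) => [->|C0]; first by rewrite cards0.
    have := noB C; rewrite C0 (subset_trans CA) ?subD1set //=.
    have -> : C != A by apply/eqP=> CAe; move/subsetP/(_ i): CA; rewrite CAe iA !inE eqxx => /(_ isT).
    rewrite /= -ltnNge => ltC.
    suff sub : related r C \subset s |: related r' C.
      by have := subset_leq_card sub; rewrite cardsU1; lia.
    apply/subsetP=> u /relP[j jC rju]; rewrite in_setU1.
    case: eqVneq => //= us; apply/relP; exists j => //.
    by rewrite /r' rju us.
  exists (fun j => if j == i then s else g j); split=> [a b aA bA|a aA] /=.
    have gs j : j \in A -> j != i -> g j != s.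
      by move=> jA ji; have := rg j; rewrite !inE ji jA => /(_ isT) /andP[].
    case: eqVneq => [->|ai]; case: eqVneq => [->|bi] // gab.
    + by have := gs _ bA bi; rewrite gab eqxx.
    + by have := gs _ aA ai; rewrite gab eqxx.
    + by apply: injg; rewrite // !inE ?ai ?bi.
  case: eqVneq => [->//|ai].
  by have := rg a; rewrite !inE ai aA => /(_ isT) /andP[].
Qed.
End Hall.

(** * Degree sums and connectedness of induced subgraphs *)

Section Graph.
Variable V : finType.
Implicit Types (G : sgraph V) (X Y : {set V}).

Definition nbh G X x : {set V} := [set y in X | adj G x y].
Definition degsum G X := \sum_(x in X) #|nbh G X x|.
(* Connectedness of the subgraph induced on [X], phrased through cuts. *)
Definition conn G X := forall Y, Y \subset X -> Y != set0 -> Y != X ->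
  exists y z, [/\ y \in Y, z \in X, z \notin Y & adj G y z].

Lemma in_nbh G X x y : (y \in nbh G X x) = (y \in X) && adj G x y.
Proof. by rewrite inE. Qed.

Lemma nbh_sub G X x : nbh G X x \subset X.
Proof. by apply/subsetP=> y; rewrite in_nbh => /andP[]. Qed.

Lemma nbhS G X Y x : X \subset Y -> nbh G X x \subset nbh G Y x.
Proof. by move=> /subsetP XY; apply/subsetP=> y; rewrite !in_nbh => /andP[/XY -> ->]. Qed.

Lemma degsumS G X Y : X \subset Y -> degsum G X <= degsum G Y.
Proof.
move=> XY; rewrite /degsum [leqRHS](big_setID X) /= (setIidPr XY).
by apply: leq_trans (leq_addr _ _); apply: leq_sum => x _; apply/subset_leq_card/nbhS.
Qed.

(** The degree of [v] itself is at least 1, and [u] loses its neighbour [v]. *)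
Lemma degsum_rem G X v u : v \in X -> u \in X -> adj G v u ->
  (degsum G (X :\ v)).+2 <= degsum G X.
Proof.
move=> vX uX vu; have uv : u != v by apply: contraTneq vu => ->; rewrite adj_irr.
rewrite /degsum [leqRHS](big_setD1 v) //= -[leqLHS]addn2 addnC.
rewrite -[2]/(1 + 1) -addnA leq_add //; first by apply/card_gt0P; exists u; rewrite in_nbh uX.
have uX' : u \in X :\ v by rewrite !inE uv.
rewrite (big_setD1 u) //= [leqRHS](big_setD1 u) //= addnA leq_add //.
  rewrite add1n; apply/proper_card/properP; split; first by rewrite nbhS ?subD1set.
  by exists v; rewrite !in_nbh ?inE ?eqxx // vX adj_sym.
by apply: leq_sum => x _; apply/subset_leq_card/nbhS/subD1set.
Qed.

(** When [L] is deleted one vertex at a time, each vertex still has its neighbour outside [L], so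
    each deletion costs at least 2. *)
Lemma degsum_leaves G X (L : {set V}) :
  L \subset X -> (forall v, v \in L -> exists2 u, u \in X :\: L & adj G v u) ->
  degsum G (X :\: L) + 2 * #|L| <= degsum G X.
Proof.
move=> LX hL; have [m] := ubnP #|L|; elim: m => // m IH in X L LX hL *.
case: (set_0Vmem L) => [-> | [v vL]]; first by rewrite cards0 setD0 addn0.
have vX : v \in X by apply: (subsetP LX).
have [u] := hL v vL; rewrite inE => /andP[uL uX] vu.
rewrite (cardsD1 v) vL add1n ltnS => ltm.
have eX : X :\: L = (X :\ v) :\: (L :\ v).
  by apply/setP=> y; rewrite !inE; case: eqVneq => //= ->; rewrite vL.
have := @IH (X :\ v) (L :\ v) (setSD _ LX).
rewrite -eX => /(_ _ ltm) h; have := degsum_rem vX uX vu.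
suff : degsum G (X :\: L) + 2 * #|L :\ v| <= degsum G (X :\ v) by lia.
apply: h => y; rewrite inE => /andP[_ yL].
by have [z zX yz] := hL _ yL; exists z.
Qed.

(** Leaves follow their neighbours: a cut [Y] of [X :\: L] extends to a cut [Y'] of [X] that no edge
    at a leaf crosses, so the edge crossing [Y'] already crosses [Y]. *)
Lemma conn_leaves G X (L : {set V}) :
  L \subset X -> (forall v, v \in L -> exists2 u, u \in X :\: L & nbh G X v = [set u]) ->
  conn G X -> conn G (X :\: L).
Proof.
move=> LX hL cX Y YX Y0 YnX.
pose Y' := Y :|: [set v in L | [exists u in Y, adj G v u]].
have YsX : Y \subset X by apply: subset_trans YX (subsetDl _ _).
have dYL y : y \in Y -> y \notin L by move/(subsetP YX); rewrite inE => /andP[].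
have [||| a [b [aY' bX bY' ab]]] := cX Y'.
- rewrite subUset YsX; apply/subsetP=> v; rewrite inE => /andP[vL _].
  exact: (subsetP LX).
- by apply: contraNneq Y0 => e; rewrite -subset0 -e subsetUl.
- apply: contraNneq YnX => e; rewrite eqEsubset YX; apply/subsetP=> z.
  by rewrite -e !inE => /andP[zL]; rewrite (negbTE zL) orbF.
have {aY'} aY : a \in Y.
  move: aY'; rewrite !inE => /orP[//|/andP[aL /exists_inP[u uY au]]].
  have [w _ e] := hL a aL; have : b \in nbh G X a by rewrite in_nbh bX.
  have : u \in nbh G X a by rewrite in_nbh (subsetP YsX).
  rewrite e !inE => /eqP uw /eqP bw.
  by move: bY'; rewrite in_setU bw -uw uY.
exists a, b; split=> //; last by apply: contra bY' => bY; rewrite inE bY.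
rewrite inE bX andbT; apply: contra bY' => bL; rewrite !inE bL /=; apply/orP; right.
by apply/exists_inP; exists a; rewrite // adj_sym.
Qed.
End Graph.

(** * Greedy embeddings *)

Lemma leq_card_bigcup (I T : finType) (P : {set I}) (F : I -> {set T}) :
  #|\bigcup_(i in P) F i| <= \sum_(i in P) #|F i|.
Proof.
elim/big_ind2: _ => [|m A n C leA leC|//]; first by rewrite cards0.
by rewrite cardsU; lia.
Qed.

Lemma subset_card_exists (T : finType) (A : {set T}) m :
  m <= #|A| -> exists2 C : {set T}, C \subset A & #|C| = m.
Proof.
elim: m => [|m IH] leA; first by exists set0; rewrite ?sub0set ?cards0.
have [C CA cC] := IH (ltnW leA).
have : 0 < #|A :\: C| by have := cardsID C A; rewrite (setIidPr CA); lia.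
move=> /card_gt0P[a]; rewrite inE => /andP[aC aA].
by exists (a |: C); rewrite ?subUset ?sub1set ?aA // cardsU1 aC cC.
Qed.

Section Embedding.
Variables (V W : finType) (H : sgraph W).
Implicit Types (G : sgraph V) (X Y L : {set V}) (A : {set W}).

(** The map is defined on all of [V] but constrained only on [X], so that adding or deleting a
    vertex does not change its type. *)
Definition is_emb G X A (f : V -> W) : Prop :=
  [/\ {in X &, injective f}, {in X, forall x, f x \in A} &
      {in X &, forall x y, adj G x y -> adj H (f x) (f y)}].

Lemma is_embS G X Y A (C : {set W}) f : Y \subset X -> A \subset C ->
  is_emb G X A f -> is_emb G Y C f.
Proof.
move=> /subsetP YX /subsetP AC [fi fA fe]; split=> [x y /YX xX /YX yX|x /YX xX|x y /YX xX /YX yX].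
- exact: fi.
- exact/AC/fA.
- exact: fe.
Qed.

(** The last hypothesis makes [L] independent, so every new edge joins [L] to a vertex placed by
    [f]. *)
Lemma emb_indep G X L A f g :
  is_emb G (X :\: L) A f -> {in L &, injective g} ->
  (forall v, v \in L -> g v \in A /\ g v \notin f @: (X :\: L)) ->
  (forall v u, v \in L -> u \in X -> adj G v u ->
     u \notin L /\ adj H (f u) (g v)) ->
  is_emb G X A (fun v => if v \in L then g v else f v).
Proof.
move=> [fi fA fe] gi gA ge.
have inD y : y \in X -> y \in L = false -> y \in X :\: L by rewrite inE => -> ->.
split=> [x y xX yX|x xX|x y xX yX xy] /=.
- case: ifP => xL; case: ifP => yL e.
  + exact: gi.
  + by have [_ /negP[]] := gA x xL; rewrite e imset_f // inD.
  + by have [_ /negP[]] := gA y yL; rewrite -e imset_f // inD.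
  + by apply: fi; rewrite ?inD.
- by case: ifP => xL; [have [] := gA x xL | apply: fA; apply: inD].
- case: ifP => xL; case: ifP => yL.
  + by have [] := ge x y xL yX xy; rewrite yL.
  + by have [_] := ge x y xL yX xy; rewrite adj_sym.
  + by rewrite adj_sym in xy; have [_] := ge y x yL xX xy.
  + by apply: fe; rewrite ?inD.
Qed.

Lemma card_emb G X A f : is_emb G X A f -> #|f @: X| = #|X|.
Proof. by case=> fi _ _; rewrite card_in_imset. Qed.
End Embedding.

Section Greedy.
Variables (V W : finType) (B : sgraph W).
Implicit Types (G : sgraph V) (X Y L : {set V}) (A : {set W}).

Lemma min_degree G X Y : Y \subset X -> Y != set0 ->
  exists2 v, v \in Y & #|Y| * #|nbh G X v| <= degsum G X.
Proof.
move=> YX /set0Pn[v0 v0Y].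
case: (arg_minnP (fun v => #|nbh G X v|) v0Y) => v vY vmin.
exists v => //; rewrite -sum_nat_const.
apply: (@leq_trans (\sum_(u in Y) #|nbh G X u|)); first exact: leq_sum.
by rewrite /degsum [leqRHS](big_setID Y) /= (setIidPr YX) leq_addr.
Qed.

(* Vertices of [A] are pairwise red up to [d] exceptions each, so the partial
   embedding extends one vertex at a time when the vertices of [X] are removed
   in order of minimum degree; [j * e <= q] holds for the minimum degree [e]
   of each of the remaining subgraphs on [j] vertices. *)
Lemma near_clique_root G X w A x d g q :
  w \in X -> (forall a, a \in A -> #|nbh B A a| <= d) ->
  #|nbh B A x| <= d + g -> degsum G X <= q ->
  (forall j e, 0 < j < #|X| -> e <= j -> j * e <= q -> j + d * e + g <= #|A :\ x|) ->
  exists f, [/\ f w = x, {in X :\ w, forall u, f u \in A :\ x} &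
    is_emb (compl B) G X setT f].
Proof.
move=> wX degA degx degX room.
(* The root [w] is placed from the start and only [Y] grows, so the image [x] of the root stays
   fixed. *)
suff grow Y : Y \subset X :\ w -> exists f,
    [/\ f w = x, {in Y, forall u, f u \in A :\ x} & is_emb (compl B) G (w |: Y) setT f].
  by have [f] := grow _ (subxx _); rewrite setD1K //; exists f.
have [m] := ubnP #|Y|; elim: m => // m IH in Y *; rewrite ltnS => leY YX.
case: (eqVneq Y set0) => [->|Y0].
  exists (fun=> x); split=> [//|u|]; first by rewrite inE.
  by split=> // u v; rewrite !inE orbF => /eqP-> /orP[/eqP-> //|]; rewrite ?adj_irr ?inE.
have wY : w \notin Y by apply/negP => /(subsetP YX); rewrite !inE eqxx.
have wYX : w |: Y \subset X.
  by rewrite subUset sub1set wX (subset_trans YX) ?subD1set.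
have [v vY vmin] := min_degree G (subsetUr [set w] Y) Y0.
have vw : v != w by apply: contraNneq wY => <-.
(* The degree of [v] is minimal over [Y], the root being left out; [#|Y|] and [#|N|] play the roles
   of [j] and [e] in [room]. *)
set N := nbh G (w |: Y) v in vmin *.
have [||f [fw fY femb]] := IH (Y :\ v).
- by move: leY; rewrite (cardsD1 v) vY; lia.
- exact: subset_trans (subD1set _ _) YX.
have eY : w |: (Y :\ v) = (w |: Y) :\ v.
  by apply/setP=> u; rewrite !inE; case: (eqVneq u v) => //= ->; rewrite (negbTE vw).
rewrite eY in femb.
have N_in u : u \in N -> u = w \/ u \in Y :\ v.
  rewrite in_nbh !inE => /andP[/orP[/eqP->|uY] vu]; [by left|right].
  by rewrite uY andbT; apply: contraTneq vu => ->; rewrite adj_irr.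
have fA u : u \in N -> f u = x \/ f u \in A.
  by case/N_in => [->|/fY]; rewrite ?fw; [left|rewrite inE => /andP[]; right].
have leN : #|N| <= #|Y|.
  have : N \subset (w |: Y) :\ v.
    apply/subsetP=> u uN; rewrite !inE.
    by case: (N_in u uN) => [->|]; rewrite ?inE ?eqxx ?(eq_sym w) ?vw // => /andP[-> ->]; rewrite orbT.
  by move/subset_leq_card; rewrite -eY cardsU1 !inE (negbTE wY) andbF (cardsD1 v Y) vY; lia.
(* The new vertex must avoid the blue neighbours of the images of [N]; only the image of the root
   can have more than [d] of them, by at most [g]. *)
have cost : \sum_(u in N) #|nbh B A (f u)| <= d * #|N| + g.
  have bound u : u \in N -> u != w -> #|nbh B A (f u)| <= d.
    by move=> /N_in[->|/fY]; rewrite ?eqxx // inE => /andP[_ /degA].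
  case: (boolP (w \in N)) => wN.
    rewrite (big_setD1 w) //= fw (cardsD1 w N) wN.
    have : \sum_(u in N :\ w) #|nbh B A (f u)| <= #|N :\ w| * d.
      rewrite -sum_nat_const; apply: leq_sum => u.
      by rewrite in_setD1 => /andP[uw uN]; apply: bound.
    by lia.
  apply: leq_trans (leq_addr _ _); rewrite mulnC -sum_nat_const; apply: leq_sum => u uN.
  by apply: bound => //; apply: contraNneq wN => <-.
have cand : 0 < #|(A :\ x) :\: (f @: (Y :\ v) :|: \bigcup_(u in N) nbh B A (f u))|.
  have h1 : #|\bigcup_(u in N) nbh B A (f u)| <= \sum_(u in N) #|nbh B A (f u)| :=
  leq_card_bigcup _ _.
  have h2 : #|f @: (Y :\ v)| <= #|Y :\ v| := leq_imset_card _ _.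
  have h3 := cardsU (f @: (Y :\ v)) (\bigcup_(u in N) nbh B A (f u)).
  have h4 := cardsD (A :\ x) (f @: (Y :\ v) :|: \bigcup_(u in N) nbh B A (f u)).
  have h5 := subset_leq_card (subsetIr (A :\ x) (f @: (Y :\ v) :|: \bigcup_(u in N) nbh B A (f u))).
  have h6 := cardsD1 v Y; rewrite vY in h6.
  have /= h7 := subset_leq_card wYX; rewrite cardsU1 wY in h7.
  have := room #|Y| #|N|.
  rewrite card_gt0 Y0 leN h7 (leq_trans vmin) ?(leq_trans (degsumS G wYX)) //.
  move=> /(_ isT isT isT); lia.
have [z] := card_gt0P cand.
rewrite !inE negb_or -!andbA => /and4P[zim zbad zx zA].
pose f' := fun u => if u \in [set v] then z else f u.
have f'w : f' w = x by rewrite /f' inE eq_sym (negbTE vw).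
exists f'; split=> //.
- move=> u uY; rewrite /f' inE; case: eqVneq => [_|uv]; first by rewrite !inE zx.
  by apply: fY; rewrite !inE uv.
- apply: (emb_indep (L := [set v]) femb) => [a b|a|a u].
  + by rewrite !inE => /eqP-> /eqP->.
  + move=> _; split=> //; rewrite -eY; apply: contra zim => /imsetP[u].
    rewrite !inE => /orP[/eqP->|/andP[uv uY]] e; first by rewrite e fw eqxx in zx.
    by rewrite e imset_f // !inE uv.
  + rewrite !inE => /eqP-> uYw vu.
    have uN : u \in N by rewrite in_nbh !inE uYw.
    have uv : u != v by apply: contraTneq vu => ->; rewrite adj_irr.
    split=> //; rewrite /= /compl_rel /=; apply/andP; split.
      case: (N_in u uN) => [->|uYv]; first by rewrite fw eq_sym.
      by apply: contraNneq zim => <-; rewrite imset_f.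
    apply: contra zbad => fuz; apply/bigcupP; exists u => //.
    by rewrite in_nbh zA.
Qed.

(** Any vertex of [A] can host the root, and then [g = 0]. *)
Lemma near_clique G X A d q :
  0 < #|A| -> (forall a, a \in A -> #|nbh B A a| <= d) -> degsum G X <= q ->
  (forall j e, 0 < j < #|X| -> e <= j -> j * e <= q -> j + d * e < #|A|) ->
  exists f, is_emb (compl B) G X A f.
Proof.
move=> /card_gt0P[x xA] degA degX room.
case: (set_0Vmem X) => [->|[w wX]].
  by exists (fun=> x); split=> [u v|u|u v]; rewrite inE.
have [|j e hj ej jq|f [fw fA [fi _ fe]]] := @near_clique_root G X w A x d 0 q wX degA _ degX.
- by rewrite addn0 degA.
- by have := room j e hj ej jq; rewrite (cardsD1 x A) xA; lia.
- exists f; split=> // u uX; case: (eqVneq u w) => [->|uw]; first by rewrite fw.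
  by have := fA u; rewrite !inE uw => /(_ uX) /andP[].
Qed.

(* If the greedy extension gets stuck, one embedded vertex has so many blue
   neighbours that these alone host the whole of [X]. *)
Lemma base_embedding G X A k q :
  0 < #|A| ->
  (forall a b, a \in A -> b \in A -> adj B a b -> #|nbh B (nbh B A a) b| < k) ->
  degsum G X <= q -> #|X| + k * q < #|A| ->
  exists f, is_emb (compl B) G X A f.
Proof.
move=> A0 bookfree.
have [m] := ubnP #|X|; elim: m => // m IH in X *; rewrite ltnS => leX degX room.
case: (eqVneq X set0) => [->|X0].
  by have [x xA] := card_gt0P A0; exists (fun=> x); split=> [u v|u|u v]; rewrite inE.
have [v vX vmin] := min_degree G (subxx X) X0.
have cX : #|X| = #|X :\ v|.+1 by rewrite (cardsD1 v) vX.
have [|||f femb] := IH (X :\ v).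
- by move: leX; rewrite cX.
- by apply: leq_trans (degsumS _ (subD1set _ _)) degX.
- by move: room; rewrite cX; lia.
set N := nbh G X v in vmin *.
have NX u : u \in N -> u \in X :\ v.
  by rewrite in_nbh !inE => /andP[-> vu]; rewrite andbT; apply: contraTneq vu => ->; rewrite adj_irr.
have leN : #|N| < #|X|.
  by rewrite cX ltnS; apply/subset_leq_card/subsetP => u /NX.
have [fi fA fe] := femb.
case: (boolP [exists z in A, (z \notin f @: (X :\ v)) &&
                [forall u in N, ~~ adj B (f u) z]]).
  case/exists_inP=> z zA /andP[zim /forall_inP zN].
  exists (fun u => if u \in [set v] then z else f u).
  apply: (emb_indep (L := [set v]) femb) => [a b|a|a u].
  + by rewrite !inE => /eqP-> /eqP->.
  + by move=> _; split.
  + rewrite !inE => /eqP-> uX vu; have uN : u \in N by rewrite in_nbh uX.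
    have /NX uXv := uN; have := uXv; rewrite !inE => /andP[uv _]; split=> //.
    rewrite /= /compl_rel /= zN // andbT.
    by apply: contraNneq zim => <-; rewrite imset_f.
move=> /exists_inPn stuck.
have cover : A \subset f @: (X :\ v) :|: \bigcup_(u in N) nbh B A (f u).
  apply/subsetP=> z zA; have := stuck z zA; rewrite negb_and negbK in_setU.
  case/orP=> [->//|]; rewrite negb_forall => /existsP[u]; rewrite negb_imply negbK.
  case/andP=> uN fuz; apply/orP; right; apply/bigcupP; exists u => //.
  by rewrite in_nbh zA.
have h1 : #|\bigcup_(u in N) nbh B A (f u)| <= \sum_(u in N) #|nbh B A (f u)| :=
  leq_card_bigcup _ _.
have h2 : #|f @: (X :\ v)| <= #|X :\ v| := leq_imset_card _ _.
have h3 := cardsU (f @: (X :\ v)) (\bigcup_(u in N) nbh B A (f u)).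
have h4 := subset_leq_card cover.
have [N0 | [u0 u0N]] := set_0Vmem N.
  by move: h1 h2 h3 h4; rewrite N0 !big_set0 !cards0; lia.
(* The blue neighbourhoods of the images of [N], together with the used vertices, cover [A]; the
   largest of them, [D], satisfies [k * q < #|N| * #|D|]. *)
case: (arg_maxnP (fun u => #|nbh B A (f u)|) u0N) => u uN umax.
set D := nbh B A (f u) in umax.
have fuA : f u \in A by apply/fA/NX.
have h5 : \sum_(i in N) #|nbh B A (f i)| <= #|N| * #|D|.
  by rewrite -sum_nat_const leq_sum.
have D0 : 0 < #|D| by rewrite lt0n; apply/eqP=> D0; move: h5; rewrite D0; lia.
have degD a : a \in D -> #|nbh B D a| < k.
  by rewrite in_nbh => /andP[aA fua]; apply: bookfree.
have k0 : 0 < k by have [a /degD] := card_gt0P D0; lia.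
have [|j e /andP[_ jX] ej jq|f' [fi' fA' fe']] := @near_clique G X D k.-1 q D0 _ degX.
- by move=> a /degD; lia.
(* After multiplication by [#|N|] both terms are controlled: minimality of [v] gives
   [#|N| * #|X| <= q], and [e <= j < #|X|]. So [#|N| * #|D| <= k * q], a contradiction. *)
- rewrite ltnNge; apply/negP => leD.
  have Nq : #|N| * #|X| <= q by rewrite mulnC; apply: leq_trans vmin degX.
  have Nj : #|N| * j <= q by nia.
  have Ne : #|N| * e <= q by nia.
  have : #|N| * #|D| <= #|N| * (j + k.-1 * e) by rewrite leq_mul2l leD orbT.
  have : #|N| * (j + k.-1 * e) <= q + k.-1 * q by rewrite mulnDr mulnCA leq_add // leq_mul2l Ne orbT.
  have : q + k.-1 * q = k * q by rewrite -mulSn prednK.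
  lia.
- exists f'; split=> // a /fA'; rewrite in_nbh; by case/andP.
Qed.
End Greedy.

(** * Matchings and packings of books *)

Section Matching.
Variables (W : finType) (B : sgraph W).
Implicit Types (S Y U P : {set W}).

Fixpoint matching j S : Prop :=
  if j is j'.+1 then
    exists u v, [/\ u \in S, v \in S, adj B u v & matching j' (S :\: [set u; v])]
  else True.

Lemma card_nbhD S U x : #|nbh B S x| <= #|nbh B (S :\: U) x| + #|U|.
Proof.
have : nbh B S x \subset nbh B (S :\: U) x :|: U.
  by apply/subsetP=> y; rewrite in_setU !in_nbh !inE => /andP[-> ->]; case: (y \in U).
by move/subset_leq_card; rewrite cardsU; lia.
Qed.

(** At most [j - 1] neighbours of [y] lie in [Y], so [y] can be matched outside [Y]. Deleting both
    ends lowers the other degrees by at most 2, which is the drop of [2 * j - 1]. *)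
Lemma matching_max_degree j S Y : Y \subset S -> #|Y| = j ->
  (forall y, y \in Y -> (2 * j).-1 <= #|nbh B S y|) -> matching j S.
Proof.
elim: j S Y => //= j IH S Y YS cY degY.
have /card_gt0P[y yY] : 0 < #|Y| by rewrite cY.
have : 0 < #|nbh B S y :\: Y|.
  have : y \notin nbh B S y by rewrite in_nbh adj_irr andbF.
  have := cardsD1 y Y; rewrite yY.
  have : nbh B S y :&: Y \subset Y :\ y.
    by apply/subsetP=> z; rewrite !inE => /andP[/andP[_ yz] ->]; rewrite andbT;
       apply: contraTneq yz => ->; rewrite adj_irr.
  move/subset_leq_card; have := degY y yY; have := cardsID Y (nbh B S y).
  by rewrite cY; lia.
case/card_gt0P=> z; rewrite inE in_nbh => /and3P[zY zS yz].
exists y, z; split=> //; first exact: (subsetP YS).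
apply: (IH _ (Y :\ y)).
- apply/subsetP=> a; rewrite !inE => /andP[ay aY]; rewrite negb_or ay (subsetP YS) // andbT.
  by apply: contraNneq zY => <-.
- by have := cardsD1 y Y; rewrite yY; lia.
- move=> a; rewrite inE => /andP[_ aY]; have := degY a aY.
  have := card_nbhD S [set y; z] a; have := cards2 y z; case: eqP => /=; lia.
Qed.

(** Fewer than [t] vertices have degree at least [2 * t - 1], by [matching_max_degree]; [A] is what
    remains without them. *)
Lemma no_matching t S : 0 < t -> ~ matching t S ->
  exists A : {set W}, [/\ A \subset S, #|S| < #|A| + t &
    forall a, a \in A -> #|nbh B A a| <= 2 * t - 2].
Proof.
move=> t0 nm; pose Y := [set y in S | (2 * t).-1 <= #|nbh B S y|].
have YS : Y \subset S by apply/subsetP=> y; rewrite inE => /andP[].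
exists (S :\: Y); split; first exact: subsetDl.
- rewrite ltnNge; apply/negP => le; have /subset_card_exists[C CY cC] : t <= #|Y|.
    by have := cardsID Y S; rewrite (setIidPr YS); lia.
  case: nm; apply: (@matching_max_degree _ _ C) => //; first exact: subset_trans YS.
  by move=> y /(subsetP CY); rewrite inE => /andP[].
- move=> a; rewrite !inE => /andP[+ aS]; rewrite aS /= => le.
  have := subset_leq_card (nbhS B a (subsetDl S Y)); lia.
Qed.

(** By counting, some [v] of [A] lies outside [U] and has no neighbour in [U]. Any neighbour of [v]
    then avoids [U] too, and both ends of the edge are added to [U]. *)
Lemma matching_min_degree (A : {set W}) D j U :
  (forall a, a \in A -> 0 < #|nbh B A a| <= D) ->
  (#|U| + 2 * j.-1) * D.+1 < #|A| -> matching j (A :\: U).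
Proof.
move=> degA; elim: j U => //= j IH U room.
have : 0 < #|A :\: (U :|: \bigcup_(u in U :&: A) nbh B A u)|.
  have h : \sum_(u in U :&: A) #|nbh B A u| <= #|U :&: A| * D.
    by rewrite -sum_nat_const; apply: leq_sum => u; rewrite inE => /andP[_ /degA/andP[]].
  have h1 : #|\bigcup_(u in U :&: A) nbh B A u| <= \sum_(u in U :&: A) #|nbh B A u| :=
    leq_card_bigcup _ _.
  have h2 := cardsU U (\bigcup_(u in U :&: A) nbh B A u).
  have h3 := cardsID (U :|: \bigcup_(u in U :&: A) nbh B A u) A.
  have h4 := subset_leq_card (subsetIr A (U :|: \bigcup_(u in U :&: A) nbh B A u)).
  have h5 := subset_leq_card (subsetIl U A).
  have h6 : #|U :&: A| * D <= #|U| * D by rewrite leq_mul2r h5 orbT.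
  have h7 : #|U| * D.+1 <= (#|U| + 2 * j) * D.+1 by rewrite leq_mul2r leq_addr orbT.
  lia.
case/card_gt0P=> v; rewrite !inE negb_or => /andP[/andP[vU vN] vA].
have /andP[/card_gt0P[z zvN] _] := degA v vA; move: zvN; rewrite inE => /andP[zA vz].
have zU : z \notin U.
  apply: contra vN => zU; apply/bigcupP; exists z; first by rewrite inE zU.
  by rewrite in_nbh vA adj_sym.
exists v, z; rewrite !inE vU vA zU zA; split=> //.
rewrite setDDl; case: j IH room => // j IH room; apply: IH.
apply: leq_ltn_trans room; rewrite leq_mul2r; apply/orP; right.
by have := cards2 v z; have := cardsU U [set v; z]; case: eqP => /=; lia.
Qed.
End Matching.

(** * Vertex-disjoint blue books *)

Section Books.
Variables (W : finType) (B : sgraph W) (k : nat).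
Implicit Types (S Y U P X : {set W}).

(** A book as a vertex set with spine [u v], which suits deletion arguments; [book_map] turns it
    into a copy of [book k]. *)
Definition is_book S : Prop :=
  exists u v, [/\ u \in S, v \in S, adj B u v, #|S| = k.+2 &
    forall w, w \in S -> w != u -> w != v -> adj B u w /\ adj B v w].

Fixpoint packs j X : Prop :=
  if j is j'.+1 then exists S, [/\ is_book S, S \subset X & packs j' (X :\: S)]
  else True.

Lemma packs_sub j X Y : X \subset Y -> packs j X -> packs j Y.
Proof.
elim: j X Y => //= j IH X Y XY [S [bS SX pX]]; exists S; split=> //.
  exact: subset_trans XY.
by apply: IH pX; apply: setSD.
Qed.

Lemma book_intro u v (K : {set W}) : adj B u v -> k <= #|K| ->
  (forall w, w \in K -> adj B u w /\ adj B v w) ->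
  exists S, [/\ is_book S, u \in S, v \in S & S \subset u |: (v |: K)].
Proof.
move=> uv /subset_card_exists[C CK cC] hK.
have hC w : w \in C -> adj B u w /\ adj B v w by move/(subsetP CK)/hK.
have uC : u \notin C by apply/negP => /hC[]; rewrite adj_irr.
have vC : v \notin C by apply/negP => /hC[_]; rewrite adj_irr.
have nuv : u != v by apply: contraTneq uv => ->; rewrite adj_irr.
exists (u |: (v |: C)); rewrite ?inE ?eqxx ?orbT; split=> //; last by rewrite !setUS.
exists u, v; rewrite !inE !eqxx ?orbT; split=> //.
  by rewrite !cardsU1 !inE negb_or nuv uC vC cC.
by move=> w; rewrite !inE => /or3P[->|->|/hC].
Qed.

(** The edges of the matching are the spines and the pages come from [P]; each book uses up [k]
    pages, leaving [(j - 1) * k] common neighbours for every other spine. *)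
Lemma pack_pool j S P : [disjoint S & P] -> matching B j S ->
  (forall u v, u \in S -> v \in S -> adj B u v ->
     j * k <= #|nbh B P u :&: nbh B P v|) -> packs j (S :|: P).
Proof.
elim: j S P => //= j IH S P dSP [u [v [uS vS uv mS]]] common.
have := common u v uS vS uv; rewrite mulSn => /(leq_trans (leq_addr _ _)).
case/subset_card_exists=> K Kc cK; have KP : K \subset P.
  by apply: subset_trans Kc _; apply: subset_trans (subsetIl _ _) (nbh_sub _ _ _).
have [|w /(subsetP Kc)|T [bT uT vT TuvK]] := @book_intro u v K uv; first by rewrite cK.
  by rewrite !inE => /andP[/andP[_ ->] /andP[_ ->]].
have disj : S :&: P = set0 by apply/eqP; rewrite setI_eq0.
have dis y : y \in S -> y \notin P.
  by move=> yS; apply/negP=> yP; have := in_set0 y; rewrite -disj inE yS yP.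
exists T; split=> //.
  apply: subset_trans TuvK _; rewrite !subUset !sub1set !inE uS vS.
  exact: subset_trans (subsetUr _ _).
apply: (@packs_sub _ (S :\: [set u; v] :|: (P :\: K))); last first.
  apply: IH => //.
    rewrite -setI_eq0 -subset0 -disj; apply: setISS; exact: subsetDl.
  move=> a b; rewrite !inE => /andP[_ aS] /andP[_ bS] ab.
  have := common a b aS bS ab.
  have : nbh B P a :&: nbh B P b \subset (nbh B (P :\: K) a :&: nbh B (P :\: K) b) :|: K.
    apply/subsetP=> y; rewrite !inE => /andP[/andP[-> ->] /andP[_ ->]].
    by case: (y \in K).
  move/subset_leq_card; rewrite cardsU cK mulSn => le1 le2.
  by rewrite -(leq_add2l k); apply: leq_trans le2 (leq_trans le1 _); rewrite addnC leq_subr.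
apply/subsetP=> y; rewrite !in_setU !in_setD in_set2 => y_in.
have yT : y \notin T.
  apply: contraL y_in => /(subsetP TuvK); rewrite !in_setU !in_set1.
  case/or3P=> [/eqP->|/eqP->|yK].
  - by rewrite eqxx /= (negbTE (dis u uS)) andbF.
  - by rewrite eqxx orbT /= (negbTE (dis v vS)) andbF.
  - by rewrite yK /= orbF; apply/negP=> /andP[_ /dis]; rewrite (subsetP KP).
by rewrite yT in_setU; case/orP: y_in => /andP[_ ->]; rewrite ?orbT.
Qed.

(** Books are chosen one by one, each through its own seed in [Y] and off everything used before. *)
Lemma pack_seeds j Y U0 : #|Y| = j -> [disjoint Y & U0] ->
  (forall p U, p \in Y -> #|U| <= #|U0| + j.-1 * k.+2 ->
     exists S, [/\ is_book S, p \in S & [disjoint S :\ p & U]]) ->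
  packs j (~: U0).
Proof.
elim: j Y U0 => //= j IH Y U0 cY dY seed.
have /card_gt0P[p pY] : 0 < #|Y| by rewrite cY.
have cY' : #|Y :\ p| = j by have := cardsD1 p Y; rewrite pY; lia.
(* The remaining seeds are also avoided, so that they stay free for the later books. *)
have [|S [bS pS dS]] := seed p (U0 :|: (Y :\ p)) pY.
  by have := cardsU U0 (Y :\ p); nia.
have cS : #|S| = k.+2 by have [u [v []]] := bS.
have pU0 : p \notin U0 by have /pred0P/(_ p)/= := dY; rewrite pY /= => ->.
have hS a : a \in S -> a != p -> a \notin U0 /\ a \notin Y.
  move=> aS ap; have /pred0P/(_ a)/= := dS; rewrite !inE ap aS /=.
  by move/negbT; rewrite negb_or => /andP.
exists S; split=> //.
  apply/subsetP=> a aS; rewrite inE; case: (eqVneq a p) => [->//|ap].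
  by case: (hS a aS ap).
rewrite setDE -setCU; apply: (IH (Y :\ p)) => //.
  apply/pred0P=> a /=; apply/negbTE; rewrite !inE -andbA; apply/negP=> /and3P[ap aY].
  case/orP=> [aU|aS]; last by have [_] := hS a aS ap; rewrite aY.
  by have /pred0P/(_ a)/= := dY; rewrite aY aU.
move=> a U aY' leU; have := aY'; rewrite inE => /andP[_ aY]; apply: seed aY _.
apply: leq_trans leU _; have := cardsU U0 S; rewrite cS.
(* A seed remains, so [j.-1] is a true predecessor and the [k + 2] vertices of [S] fit into the
   allowance. *)
have : 0 < j by rewrite -cY'; apply/card_gt0P; exists a.
case: j {IH cY cY'} => // j _ /= ->.
have := subset_leq_card (subsetIl U0 S); nia.
Qed.

Lemma clique_packs j X : {in X &, forall a b, a != b -> adj B a b} ->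
  j * k.+2 <= #|X| -> packs j X.
Proof.
elim: j X => //= j IH X cl; rewrite mulSn => le.
have [S SX cS] := subset_card_exists (leq_trans (leq_addr _ _) le).
have [u uS] : exists u, u \in S by apply/card_gt0P; rewrite cS.
have [v] : exists v, v \in S :\ u.
  by apply/card_gt0P; have := cardsD1 u S; rewrite uS cS; lia.
rewrite !inE => /andP[vu vS]; have SinX := subsetP SX.
exists S; split=> //.
  exists u, v; split=> //; first by apply: cl; rewrite ?SinX // eq_sym.
  by move=> w wS wu wv; split; apply: cl; rewrite ?SinX // eq_sym.
apply: IH => [a b|]; last by have := cardsID S X; rewrite (setIidPr SX); lia.
by rewrite !inE => /andP[_ aX] /andP[_ bX]; apply: cl.
Qed.

Definition book_free X := forall S, S \subset X -> ~ is_book S.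

(** Books are removed one at a time; without [j + 1] disjoint books this stops after at most [j]
    removals. *)
Lemma packing_free j X : ~ packs j.+1 X ->
  exists U : {set W}, #|U| <= j * k.+2 /\ book_free (X :\: U).
Proof.
elim: j X => [|j IH] X np.
  by exists set0; rewrite cards0 setD0; split=> // S SX bS; apply: np; exists S.
(* The existence of a book is decided through a boolean form of [is_book]. *)
case: (boolP [forall S : {set W}, (S \subset X) ==> ~~ [exists u, exists v,
   [&& u \in S, v \in S, adj B u v, #|S| == k.+2 & [forall w in S,
     (w != u) ==> (w != v) ==> adj B u w && adj B v w]]]]).
  move=> /forall_inP nb; exists set0; rewrite cards0 setD0; split=> // S SX.
  case=> u [v [uS vS uv cS hw]]; have /negP := nb S SX; apply.
  apply/existsP; exists u; apply/existsP; exists v; rewrite uS vS uv cS eqxx /=.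
  by apply/forall_inP=> w wS; apply/implyP=> wu; apply/implyP=> wv; have [-> ->] := hw w wS wu wv.
rewrite negb_forall => /existsP[S]; rewrite negb_imply negbK => /andP[SX].
case/existsP=> u /existsP[v /and5P[uS vS uv /eqP cS /forall_inP hw]].
have bS : is_book S.
  exists u, v; split=> // w wS wu wv; have := hw w wS.
  by rewrite wu wv => /= /andP[].
have [|U [cU fU]] := IH (X :\: S).
  by move=> pX; apply: np; exists S.
exists (S :|: U); split; last by rewrite -setDDl.
by have := cardsU S U; rewrite cS mulSn; lia.
Qed.

Lemma book_free_nbh X a b : book_free X -> a \in X -> b \in X -> adj B a b ->
  #|nbh B (nbh B X a) b| < k.
Proof.
move=> fX aX bX ab; rewrite ltnNge; apply/negP => le.
have [|S [bS _ _ SX]] := book_intro ab le.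
  by move=> w; rewrite !in_nbh => /andP[/andP[_ ->] ->].
apply: fX bS; apply: subset_trans SX _; rewrite !subUset !sub1set aX bX.
by rewrite (subset_trans (nbh_sub _ _ _)) ?nbh_sub.
Qed.

(* A vertex whose blue neighbourhood contains a blue star K_{1,k} is the end of
   a spine; if this survives the deletion of any small set, the stars can be
   chosen disjoint. *)
Lemma stars_pack j Y : #|Y| = j ->
  (forall p U, p \in Y -> #|U| <= j.-1 * k.+2 ->
     exists2 c, c \in nbh B setT p :\: U & k <= #|nbh B (nbh B setT p :\: U) c|) ->
  packs j setT.
Proof.
move=> cY star; rewrite -setC0; apply: (pack_seeds cY).
  by rewrite disjoint_sym disjoints_subset sub0set.
rewrite cards0 add0n => p U pY leU; have [c] := star p U pY leU.
rewrite inE in_nbh => /and3P[cU _ pc] le.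
have [|S [bS pS _ Ssub]] := book_intro pc le.
  by move=> w; rewrite !inE => /andP[/andP[_ /andP[_ ->]] ->].
exists S; split=> //; apply/pred0P=> a /=; apply/negbTE/negP => /andP[].
rewrite !inE => /andP[ap /(subsetP Ssub)]; rewrite !inE (negbTE ap) /=.
by case/orP=> [/eqP->|/andP[/andP[/negP + _] _] //]; rewrite (negbTE cU).
Qed.

End Books.

(** * Suspended paths *)

Section Suspended.
Variable V : finType.
Implicit Types (G : sgraph V) (X Y : {set V}).

(* Only the interior vertices of [ys] are restricted; its ends may have
   neighbours off the path. *)
Definition suspended G X (ys : seq V) : Prop :=
  [/\ uniq ys, {subset ys <= X}, sorted (adj G) ys &
    forall s1 a b c s2, ys = s1 ++ [:: a, b, c & s2] ->
      forall v, v \in X -> adj G b v -> v = a \/ v = c].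

(** [G] with the edge [a c] added. On [X :\ b] it replaces the path [a b c] by an edge; that edge
    may already be in [G], so the degree sum can drop by more than 2. *)
Definition short_rel G a c : rel V := [rel u v | (u != v) &&
  [|| adj G u v, (u == a) && (v == c) | (u == c) && (v == a)]].
Lemma short_sym G a c : symmetric (short_rel G a c).
Proof.
move=> u v; rewrite /short_rel /= eq_sym adj_sym; congr (_ && _).
by rewrite [(v == a) && _]andbC [(v == c) && _]andbC [_ && _ || _]orbC.
Qed.
Lemma short_irr G a c : irreflexive (short_rel G a c).
Proof. by move=> u; rewrite /short_rel /= eqxx. Qed.
Definition short G a c : sgraph V := SGraph (short_sym G a c) (short_irr G a c).

Lemma shortW G a c u v : adj G u v -> adj (short G a c) u v.
Proof.
move=> uv; rewrite /= /short_rel /= uv /= andbT.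
by apply: contraTneq uv => ->; rewrite adj_irr.
Qed.

Lemma suspended_nth G X ys x0 i v : suspended G X ys -> 0 < i -> i.+1 < size ys ->
  v \in X -> adj G (nth x0 ys i) v -> v = nth x0 ys i.-1 \/ v = nth x0 ys i.+1.
Proof.
move=> [_ _ _ hint]; case: i => // i _ lt vX /=; apply: (hint (take i ys) _ _ _ (drop i.+3 ys)) => //.
by rewrite -!drop_nth ?cat_take_drop //; lia.
Qed.

(** A cut separating [a] from [c] is crossed by the new edge. Otherwise [b] is put on their side,
    and the edge of [G] crossing that cut avoids [b]. *)
Lemma conn_short G X a b c rest : suspended G X [:: a, b, c & rest] ->
  conn G X -> conn (short G a c) (X :\ b).
Proof.
move=> [un sub /= /and3P[ab bc _] hint] cX Y YX Y0 YnX.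
have nb v : v \in X -> adj G b v -> v = a \/ v = c by apply: (hint [::]).
have [aX cX'] : a \in X /\ c \in X by split; apply: sub; rewrite !inE eqxx ?orbT.
have [nab nbc nac] : [/\ a != b, b != c & a != c].
  by move: un; rewrite /= !inE !negb_or => /andP[/and3P[-> -> _] /andP[/andP[-> _] _]].
have YsX : Y \subset X by apply: subset_trans YX (subD1set _ _).
have bY : b \notin Y by apply/negP=> /(subsetP YX); rewrite !inE eqxx.
case: (boolP (a \in Y)) => aY; case: (boolP (c \in Y)) => cY.
- have [||| y [z [yY zX zY yz]]] := cX (b |: Y).
  + by rewrite subUset sub1set YsX andbT; apply: sub; rewrite !inE eqxx orbT.
  + by apply/set0Pn; exists b; rewrite !inE eqxx.
  + by apply: contraNneq YnX => <-; rewrite setU1K.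
  exists y, z; move: yY zY; rewrite !inE negb_or => /orP[/eqP ey|yY] /andP[zb zY].
    by case: (nb z zX); rewrite -?ey // => ez; rewrite ez ?aY ?cY in zY.
  by rewrite zb; split=> //; apply: shortW.
- exists a, c; rewrite !inE eq_sym nbc cX'; split=> //.
  by rewrite /= /short_rel /= nac !eqxx /= orbT.
- exists c, a; rewrite !inE nab aX; split=> //.
  by rewrite /= /short_rel /= eq_sym nac !eqxx /= !orbT.
- have [||| y [z [yY zX zY yz]]] := cX Y; rewrite //.
    by apply/eqP=> eY; have := sub b; rewrite -eY (negbTE bY) !inE eqxx orbT => /(_ isT).
  exists y, z; rewrite !inE zX andbT; split=> //; last exact: shortW.
  apply/eqP=> ezb; rewrite ezb adj_sym in yz.
  by case: (nb y (subsetP YsX _ yY) yz) => ey; move: yY; rewrite ey ?(negbTE aY) ?(negbTE cY).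
Qed.

(** The degree 2 of [b] disappears, while [a] and [c] lose [b] and gain at most each other. *)
Lemma degsum_short G X a b c rest : suspended G X [:: a, b, c & rest] ->
  degsum (short G a c) (X :\ b) + 2 <= degsum G X.
Proof.
move=> [un sub /= /and3P[ab bc _] hint].
have nb v : v \in X -> adj G b v -> v = a \/ v = c by apply: (hint [::]).
have [aX bX cX] : [/\ a \in X, b \in X & c \in X].
  by split; apply: sub; rewrite !inE eqxx ?orbT.
have [nab nbc nac] : [/\ a != b, b != c & a != c].
  by move: un; rewrite /= !inE !negb_or => /andP[/and3P[-> -> _] /andP[/andP[-> _] _]].
rewrite /degsum [leqRHS](big_setD1 b) //= addnC leq_add //.
  have : [set a; c] \subset nbh G X b.
    by rewrite subUset !sub1set !in_nbh aX cX adj_sym ab bc.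
  by move/subset_leq_card; rewrite cards2 nac.
have end_le x y : x \in X -> adj G x b ->
    (forall v, adj (short G a c) x v -> adj G x v \/ v = y) ->
    #|nbh (short G a c) (X :\ b) x| <= #|nbh G X x|.
  move=> xX xb hx; rewrite (cardsD1 b (nbh G X x)) in_nbh bX xb /=.
  have : nbh (short G a c) (X :\ b) x \subset y |: (nbh G X x :\ b).
    apply/subsetP=> v; rewrite in_nbh !inE => /andP[/andP[-> ->] /hx].
    by case=> ->; rewrite ?eqxx ?orbT.
  by move/subset_leq_card/leq_trans; apply; rewrite cardsU1 leq_add2r leq_b1.
apply: leq_sum => x; rewrite !inE => /andP[xb xX].
case: (eqVneq x a) => [->|xa].
  apply: (@end_le a c) => // v; rewrite /= /short_rel /= eqxx.
  by rewrite (negbTE nac) /= orbF => /andP[_ /orP[->|/eqP->]]; [left|right].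
case: (eqVneq x c) => [->|xc].
  apply: (@end_le c a) => // [|v]; first by rewrite adj_sym.
  rewrite /= /short_rel /= eqxx eq_sym (eq_sym c a) (negbTE nac) /=.
  by case/andP=> _ /orP[->|/eqP->]; [left|right].
apply/subset_leq_card/subsetP=> v; rewrite !in_nbh !inE /= /short_rel /=.
by rewrite (negbTE xa) (negbTE xc) /= orbF => /andP[/andP[_ ->] /andP[_ ->]].
Qed.

(** The only interior vertex whose neighbourhood changes is [c], which exchanges [b] for [a]. *)
Lemma suspended_short G X a b c rest : suspended G X [:: a, b, c & rest] ->
  suspended (short G a c) (X :\ b) [:: a, c & rest].
Proof.
move=> S; have [un sub so hint] := S.
have [nab nbc nac] : [/\ a != b, b != c & a != c].
  by move: un; rewrite /= !inE !negb_or => /andP[/and3P[-> -> _] /andP[/andP[-> _] _]].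
move: (un) => /= /and3P[]; rewrite !inE !negb_or => /and3P[_ _ ar] /andP[_ br] /andP[cr ur].
split.
- by rewrite /= !inE negb_or nac ar cr.
- move=> v vin; rewrite !inE sub; last by move: vin; rewrite !inE => /orP[->|->]; rewrite ?orbT.
  rewrite andbT; move: vin; rewrite !inE => /or3P[/eqP->|/eqP->|vr] //; first by rewrite eq_sym.
  by apply: contraNneq br => <-.
- move: so => /= /and3P[_ _ pr]; apply/andP; split.
    by rewrite /short_rel /= nac !eqxx /= orbT.
  by apply: sub_path pr => u v; apply: shortW.
- move=> [|z s1] p q r s2 /=.
    case=> <- <- er v; rewrite !inE => /andP[vb vX]; rewrite /short_rel /=.
    case/andP=> cv /orP[cv'|/orP[/andP[/eqP ca _]|/andP[_ /eqP->]]]; last by left.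
      have [||] := hint [:: a] b c r s2 _ v vX cv'; first by rewrite er.
        by move=> ev; rewrite ev eqxx in vb.
      by right.
    by rewrite ca eqxx in nac.
  case=> _ er v; rewrite !inE => /andP[vb vX].
  have qr : q \in rest.
    case: s1 er => [|z' s1] /= [_ ->]; first by rewrite inE eqxx.
    by rewrite mem_cat !inE eqxx !orbT.
  rewrite /short_rel /=; have -> : q == c = false by apply: contraNF cr => /eqP<-.
  have -> : q == a = false by apply: contraNF ar => /eqP<-.
  rewrite /= orbF => /andP[_ qv].
  by apply: (hint [:: a, b & s1] p q r s2) => //=; rewrite -er.
Qed.

Lemma suspended_size3 G X ys : suspended G X ys -> 2 < size ys ->
  exists a b c rest, ys = [:: a, b, c & rest].
Proof. by case: ys => [|a [|b [|c rest]]] //= _ _; exists a, b, c, rest. Qed.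
End Suspended.

Section Lengthen.
Variables (W : finType) (H : sgraph W).
Implicit Types (p : seq W).

(** The vertices of [p] may be reordered, but both ends are kept. *)
Definition longer p y p' : Prop :=
  [/\ uniq p', sorted (adj H) p', size p' = (size p).+1, p' =i y :: p &
    forall d, head d p' = head d p /\ last d p' = last d p].

Lemma insert_longer p p1 x h p2 y : p = p1 ++ [:: x, h & p2] ->
  uniq p -> sorted (adj H) p -> y \notin p -> adj H x y -> adj H y h ->
  longer p y (p1 ++ [:: x, y, h & p2]).
Proof.
move=> -> un so yp xy yh.
have pe : perm_eq (p1 ++ [:: x, y, h & p2]) (y :: p1 ++ [:: x, h & p2]).
  by apply/permP=> P; rewrite /= !count_cat /=; lia.
split.
- by rewrite (perm_uniq pe) /= yp un.
- case: p1 {un yp pe} so => [|z p1] /=; rewrite ?cat_path /= xy yh /=.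
    by case/andP.
  by case/and4P=> -> -> _ ->.
- by rewrite (perm_size pe).
- exact: perm_mem.
- by move=> d; split; [case: p1 {un so yp pe}|rewrite !last_cat].
Qed.

(** A rotation: from [x] to [y], then to the far end of the segment [h :: m], back along it to [h],
    and on to [x']. *)
Lemma flip_longer p p1 x h m x' p2 y : p = p1 ++ x :: (h :: m) ++ x' :: p2 ->
  uniq p -> sorted (adj H) p -> y \notin p ->
  adj H x y -> adj H y (last h m) -> adj H h x' ->
  longer p y (p1 ++ x :: y :: rev (h :: m) ++ x' :: p2).
Proof.
move=> -> un so yp xy yl hx'.
have pe : perm_eq (p1 ++ x :: y :: rev (h :: m) ++ x' :: p2)
                  (y :: p1 ++ x :: (h :: m) ++ x' :: p2).
  by apply/permP=> P; rewrite /= !(count_cat, count_rev) /= !(count_cat, count_rev) /=; lia.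
have pm : path (adj H) y (rev (h :: m) ++ x' :: p2) = path (adj H) h m && path (adj H) x' p2.
  rewrite cat_path {2}rev_cons last_rcons /= hx' /=; congr (_ && _).
  have -> : path (adj H) h m = sorted (adj H) (rev (h :: m)).
    by rewrite rev_sorted; rewrite /=; apply: eq_path => u v; rewrite adj_sym.
  by rewrite lastI rev_rcons /= yl.
split.
- by rewrite (perm_uniq pe) /= yp un.
- move: (rev _) pm => r pm.
  case: p1 {un yp pe} so => [|z p1] /=.
    by rewrite xy pm cat_path /= => /and4P[_ -> _ ->].
  rewrite !cat_path /= cat_path /= xy /=; move: pm; rewrite cat_path /= => ->.
  by case/and5P=> -> -> _ -> /andP[_ ->].
- by rewrite (perm_size pe).
- exact: perm_mem.
- by move=> d; split; [case: p1 {un so yp pe}|rewrite !last_cat /= !last_cat].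
Qed.

(** Interior vertices of a suspended path have no edges off the path, so their images may be
    permuted: the path is laid along [p'] in order, and its ends keep their images. *)
Lemma emb_longer (V : finType) (G : sgraph V) X U a b c rest f y p' :
  suspended G X [:: a, b, c & rest] ->
  is_emb H (short G a c) (X :\ b) U f ->
  y \in U -> y \notin f @: (X :\ b) ->
  longer (map f [:: a, c & rest]) y p' ->
  exists f', is_emb H G X U f'.
Proof.
move=> S [fi fU fe] yU yf [un so sz mem ends].
have [uys sub _ _] := S.
set ys := [:: a, b, c & rest] in S uys sub *.
have szp : size p' = size ys by rewrite sz size_map.
have [nab nbc] : a != b /\ b != c.
  by move: uys; rewrite /= !inE !negb_or => /andP[/and3P[-> _ _] /andP[/andP[-> _] _]].
have short_in v : v \in [:: a, c & rest] -> v \in X :\ b.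
  move=> vs; rewrite !inE sub; last by move: vs; rewrite !inE => /orP[->|->]; rewrite ?orbT.
  rewrite andbT; apply: contraTneq vs => ->; rewrite !inE !negb_or eq_sym nab nbc.
  by move: uys => /= /and3P[_]; rewrite inE negb_or => /andP[].
pose f' v := if v \in ys then nth (f a) p' (index v ys) else f v.
have f'p v : v \in ys -> f' v \in p'.
  by move=> vy; rewrite /f' vy mem_nth // szp index_mem.
have p'_case z : z \in p' -> z = y \/ exists2 v, v \in [:: a, c & rest] & z = f v.
  by rewrite mem inE => /orP[/eqP->|/mapP]; [left|right].
have f'a : f' a = f a.
  rewrite /f' inE eqxx /= eqxx; have [] := ends (f a); rewrite /= => <- _.
  by case: (p').
have bl : last c rest != b.
  have := mem_last c rest; apply: contraTneq => ->.
  by move: uys => /= /and3P[_].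
have f'l : f' (last c rest) = f (last c rest).
  rewrite /f' ifT; last by rewrite 2!inE mem_last !orbT.
  rewrite (_ : index _ ys = (size p').-1); last by rewrite szp; apply: (index_last uys).
  by rewrite nth_last; have [_ ->] := ends (f a); rewrite /= last_map.
have interior u v : u \in ys -> 0 < index u ys -> (index u ys).+1 < size ys ->
    v \in X -> adj G u v -> adj H (f' u) (f' v).
  move=> uy i0 il vX; rewrite -{1}(nth_index a uy) => uv.
  have lt1 : (index u ys).-1 < size ys by apply: leq_ltn_trans (leq_pred _) (ltnW il).
  case: (suspended_nth S i0 il vX uv) => ->; rewrite /f' uy mem_nth // index_uniq //.
    rewrite adj_sym -{2}(prednK i0); apply: (elimT (sortedP (f a)) so).
    by rewrite prednK // szp ltnW.
  by apply: (elimT (sortedP (f a)) so); rewrite szp.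
have endpoint u : u \in ys -> (0 < index u ys) && ((index u ys).+1 < size ys) = false ->
    f' u = f u /\ u != b.
  move=> uy; have := uy; rewrite -index_mem => lt.
  case: posnP => [i0 _|i0 /= le].
    by rewrite -(nth_index a uy) i0 /= nab.
  move/negbT: le; rewrite -leqNgt => le; have iu : index u ys = (size ys).-1.
    by apply/eqP; rewrite -eqSS [(size ys).-1.+1](_ : _ = size ys) // eqn_leq lt.
  by rewrite -(nth_index a uy) iu nth_last /=.
exists f'; split=> [u v uX vX|u uX|u v uX vX uv].
- have out w w' : w \in ys -> w' \in X -> w' \notin ys -> f' w = f w' -> False.
    move=> wy wX w'y e; have w'b : w' \in X :\ b.
      by rewrite !inE wX andbT; apply: contraNneq w'y => ->; rewrite !inE eqxx orbT.
    case: (p'_case _ (f'p w wy)) => [ey|[v0 v0s ev]].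
      by rewrite -ey e imset_f in yf.
    have ew : w' = v0 by apply: fi; rewrite -?e -?ev // short_in.
    by move: w'y v0s; rewrite ew !inE => /norP[/negbTE-> /norP[_ /norP[/negbTE-> /negbTE->]]].
  case: (boolP (u \in ys)) => uy; case: (boolP (v \in ys)) => vy.
  + rewrite /f' uy vy => /eqP; rewrite nth_uniq ?szp ?index_mem // => /eqP e.
    by rewrite -(nth_index a uy) e nth_index.
  + by rewrite {2}/f' (negbTE vy) => /out[].
  + by rewrite {1}/f' (negbTE uy) => /esym/out[].
  + rewrite /f' (negbTE uy) (negbTE vy); apply: fi; rewrite !inE ?uX ?vX andbT.
      by apply: contraNneq uy => ->; rewrite !inE eqxx orbT.
    by apply: contraNneq vy => ->; rewrite !inE eqxx orbT.
- case: (boolP (u \in ys)) => uy.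
    by case: (p'_case _ (f'p u uy)) => [->//|[v0 v0s ->]]; apply/fU/short_in.
  rewrite /f' (negbTE uy); apply: fU; rewrite !inE uX andbT.
  by apply: contraNneq uy => ->; rewrite !inE eqxx orbT.
(* Every vertex that is not interior to the path keeps its image, so edges between two such vertices
   are inherited from [f]. *)
- have same w : w \in X -> (w \in ys) && ((0 < index w ys) && ((index w ys).+1 < size ys)) = false ->
      f' w = f w /\ w \in X :\ b.
    move=> wX; case: (boolP (w \in ys)) => wy /=.
      by case/(endpoint w wy) => -> wb; rewrite !inE wb.
    move=> _; rewrite /f' (negbTE wy) !inE wX andbT; split=> //.
    by apply: contraNneq wy => ->; rewrite !inE eqxx orbT.
  case: (boolP ((u \in ys) && ((0 < index u ys) && ((index u ys).+1 < size ys)))).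
    by case/and3P=> uy u0 ul; apply: interior.
  move/negbTE/(same u uX) => [eu uXb].
  case: (boolP ((v \in ys) && ((0 < index v ys) && ((index v ys).+1 < size ys)))).
    case/and3P=> vy v0 vl; have := interior v u vy v0 vl uX; rewrite adj_sym => /(_ uv).
    by rewrite adj_sym.
  move/negbTE/(same v vX) => [-> vXb]; rewrite eu.
  by apply: fe => //; apply: shortW.
Qed.
End Lengthen.

(** * Lengthening red paths *)

Section PathExtension.
Variables (W : finType) (B : sgraph W).
Variables (x0 : W) (s : seq W).
Let p := x0 :: s.
(** The vertices of the path that have a successor; [nx] is that successor. *)
Let front := [set z in belast x0 s].
Let nx z := nth x0 p (index z p).+1.
Hypothesis p_uniq : uniq p.
Hypothesis p_red : sorted (adj (compl B)) p.

Lemma front_index z : z \in front -> index z p < size s /\ nth x0 p (index z p) = z.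
Proof.
rewrite inE => zb; have zp : z \in p by rewrite /p lastI mem_rcons inE zb orbT.
split; last exact: nth_index.
by rewrite /p lastI -cats1 index_cat zb -(size_belast x0) index_mem.
Qed.

Lemma card_front : #|front| = size s.
Proof.
rewrite cardsE (card_uniqP _) ?size_belast //.
by move: p_uniq; rewrite /p lastI rcons_uniq => /andP[].
Qed.

Lemma nx_inj : {in front &, injective nx}.
Proof.
move=> z w /front_index[iz ez] /front_index[iw ew] /eqP.
by rewrite /nx nth_uniq // eqSS => /eqP e; rewrite -ez -ew e.
Qed.

Lemma split2 i : i.+1 < size p ->
  p = take i p ++ [:: nth x0 p i, nth x0 p i.+1 & drop i.+2 p].
Proof. by move=> lt; rewrite -!drop_nth ?cat_take_drop // ltnW. Qed.

Lemma compl_adjN y z : y != z -> adj B y z = false -> adj (compl B) y z.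
Proof. by move=> yz nyz; rewrite /= /compl_rel /= yz nyz. Qed.

Variable y : W.
Hypothesis y_notin : y \notin p.

Lemma in_p_neq i : i < size p -> y != nth x0 p i.
Proof. by move=> lt; apply: contraNneq y_notin => ->; rewrite mem_nth. Qed.

(* The successors of the red neighbours of [y] on a path that cannot be
   lengthened through [y] form, together with [y], a blue clique. *)
Lemma few_red_neighbours k j :
  (forall p', ~ longer (compl B) p y p') -> ~ packs B k j setT ->
  (#|nbh (compl B) front y|).+1 < j * k.+2.
Proof.
move=> stuck; rewrite ltnNge => np; apply/negP => le; apply: np.
(* If [y] were red to two consecutive vertices, it could be inserted between them. *)
have c1 i : i.+1 < size p -> adj (compl B) y (nth x0 p i) -> adj B y (nth x0 p i.+1).
  move=> lt yi; apply: contraT => /negbTE /(compl_adjN (in_p_neq lt)) yi'.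
  by case: (stuck _ (insert_longer (split2 lt) p_uniq p_red y_notin _ yi')); rewrite adj_sym.
(* If two successors were joined in red, the segment between them could be reversed and [y]
   inserted. *)
have c2 i i' : i < i' -> i'.+1 < size p -> adj (compl B) y (nth x0 p i) ->
    adj (compl B) y (nth x0 p i') -> adj B (nth x0 p i.+1) (nth x0 p i'.+1).
  move=> ii' lt yi yi'; have lti : i.+1 < size p by apply: leq_ltn_trans (ltnW lt).
  have ne : nth x0 p i.+1 != nth x0 p i'.+1 by rewrite nth_uniq //; lia.
  apply: contraT => /negbTE /(compl_adjN ne) hh.
  pose m := take (i' - i.+1) (drop i.+2 p).
  have e1 : nth x0 p i.+1 :: m = take (i' - i) (drop i.+1 p).
    by rewrite (drop_nth x0 lti) -(subnSK ii').
  have e2 : p = take i p ++ nth x0 p i :: (nth x0 p i.+1 :: m) ++ nth x0 p i'.+1 :: drop i'.+2 p.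
    rewrite e1 -drop_nth // -[LHS](cat_take_drop i); congr (_ ++ _).
    rewrite (drop_nth x0 (ltnW lti)); congr (_ :: _).
    rewrite -[LHS](cat_take_drop (i' - i)); congr (_ ++ _).
    by rewrite drop_drop; congr (drop _ _); lia.
  have e3 : last (nth x0 p i.+1) m = nth x0 p i'.
    rewrite (last_nth x0) e1 size_take size_drop.
    have -> : (if i' - i.+1 < size p - i.+2 then i' - i.+1 else size p - i.+2) = i' - i.+1.
      by case: ifP; lia.
    by rewrite nth_take ?nth_drop; [congr (nth _ _ _)|]; lia.
  case: (stuck _ (flip_longer e2 p_uniq p_red y_notin _ _ hh)); first by rewrite adj_sym.
  by rewrite e3.
set N := nbh _ _ _ in le.
have Nf z : z \in N -> [/\ z \in front, (index z p).+1 < size p & adj (compl B) y (nth x0 p (index z p))].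
  rewrite in_nbh => /andP[zf yz]; have [lt e] := front_index zf.
  by split=> //; rewrite e.
apply: (@packs_sub _ _ _ _ (y |: nx @: N)) (subsetT _) _; apply: clique_packs.
  have sub z : z \in N -> adj B y (nx z) by case/Nf=> _ lt yz; apply: c1.
  have sub2 z w : z \in N -> w \in N -> nx z != nx w -> adj B (nx z) (nx w).
    move=> /Nf[_ ltz yz] /Nf[_ ltw yw] ne.
    case: (ltngtP (index z p) (index w p)) => [lt|lt|e]; first exact: c2.
      by rewrite adj_sym; apply: c2.
    by rewrite /nx e eqxx in ne.
  move=> a b; rewrite !in_setU1 => /orP[/eqP->|/imsetP[z zN ->]] /orP[/eqP->|/imsetP[w wN ->]].
  - by rewrite eqxx.
  - by move=> _; apply: sub.
  - by move=> _; rewrite adj_sym; apply: sub.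
  - exact: sub2.
rewrite cardsU1 card_in_imset; last first.
  by move=> z w /Nf[zf _ _] /Nf[wf _ _]; apply: nx_inj.
rewrite (_ : y \notin _ = true) //; apply/imsetP=> -[z /Nf[_ lt _] e].
by have := in_p_neq lt; rewrite {1}e eqxx.
Qed.

(** Each blue neighbour of [y] spoils at most two of the [size s] consecutive pairs, so some pair is
    red to [y] on both sides. *)
Lemma insert_near_clique d :
  #|nbh B [set z in p] y| <= d -> 2 * d < size s -> exists p', longer (compl B) p y p'.
Proof.
move=> degy room; set D := nbh _ _ _ in degy.
case: (boolP [exists z in front, (z \notin D) && (nx z \notin D)]).
  case/exists_inP=> z zf /andP[zD nD]; have [lt e] := front_index zf.
  have lt' : (index z p).+1 < size p by [].
  have inD i : i < size p -> (nth x0 p i \in D) = adj B y (nth x0 p i).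
    by move=> lti; rewrite in_nbh inE mem_nth.
  eexists; apply: (insert_longer (split2 lt') p_uniq p_red y_notin).
    rewrite adj_sym; apply: compl_adjN; first by apply: in_p_neq; apply: ltnW.
    by rewrite -inD ?e ?(negbTE zD) // ltnW.
  by apply: compl_adjN; rewrite ?in_p_neq // -inD // (negbTE nD).
move=> /exists_inPn none; exfalso.
have cov : front \subset D :|: [set z in front | nx z \in D].
  apply/subsetP=> z zf; have := none z zf; rewrite negb_and !negbK !inE.
  by case/orP=> ->; rewrite ?orbT // -[_ \in belast _ _]in_set zf orbT.
have h1 := subset_leq_card cov; rewrite card_front in h1.
have h2 : #|[set z in front | nx z \in D]| <= #|D|.
  rewrite -(card_in_imset (f := nx)); last first.
    by move=> a b; rewrite !(inE, in_set) => /andP[af _] /andP[bf _]; apply: nx_inj; rewrite inE.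
  by apply/subset_leq_card/subsetP=> ? /imsetP[z + ->]; rewrite inE => /andP[].
have := cardsU D [set z in front | nx z \in D]; lia.
Qed.
End PathExtension.

(** * Reinserting a vertex of a suspended path *)

Section PathStep.
Variables (V W : finType) (B : sgraph W).
Implicit Types (G : sgraph V) (X : {set V}) (A U : {set W}).

Lemma emb_path G X U ys f : suspended G X ys -> is_emb (compl B) G X U f ->
  [/\ uniq (map f ys), sorted (adj (compl B)) (map f ys) &
      forall z, z \in map f ys -> z \in U /\ z \in f @: X].
Proof.
move=> [un sub so _] [fi fU fe]; split.
- by rewrite map_inj_in_uniq // => u v /sub uX /sub vX; apply: fi.
- rewrite sorted_map; apply: (@sub_in_sorted _ (mem X) (adj G)) so; last exact/allP.
  by move=> u v uX vX; apply: fe.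
- by move=> z /mapP[v /sub vX ->]; split; [apply: fU|apply: imset_f].
Qed.

(** At minimum degrees up to 2 the greedy embedding needs [2 * d] spare vertices. Shortening the
    path [i] times provides them, and the removed vertices return through [insert_near_clique]. *)
Lemma near_clique_path i G X ys A d n q :
  suspended G X ys -> 2 * d + 2 + i <= size ys -> degsum G X <= q ->
  #|X| + 2 * d <= #|A| + i -> #|X| <= #|A| -> n <= #|A| ->
  (forall a, a \in A -> #|nbh B A a| <= d) ->
  (forall j e, e <= j -> j * e <= q -> e <= 2 \/ j + d * e < n) ->
  exists f, is_emb (compl B) G X A f.
Proof.
move=> + + + + + nA degA room; elim: i G X ys => [|i IH] G X ys S szys degX slack XA.
  apply: (near_clique _ degA degX) => [|j e /andP[_ jX] ej jq].
    have [_ sub _ _] := S; apply: leq_trans XA; apply/card_gt0P.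
    by case: ys S szys sub => [|v ys]; [rewrite addn0 addn2|exists v; apply: sub; rewrite inE eqxx].
  case: (room j e ej jq) => [e2|]; last by move=> lt; apply: leq_trans lt nA.
  have : d * e <= d * 2 by rewrite leq_mul2l e2 orbT.
  lia.
have [|a [b [c [rest eys]]]] := suspended_size3 S; first by lia.
rewrite {}eys in S szys *; have Ss := suspended_short S.
have bX : b \in X by have [_ sub _ _] := S; apply: sub; rewrite !inE eqxx orbT.
have cX := cardsD1 b X; rewrite bX in cX.
have [||||f femb] := IH (short G a c) (X :\ b) _ Ss.
- by move: szys => /=; lia.
- by have := degsum_short S; lia.
- by lia.
- by lia.
have [un so pim] := emb_path Ss femb.
have : 0 < #|A :\: f @: (X :\ b)|.
  by rewrite cardsD subn_gt0; apply: leq_ltn_trans (subset_leq_card (subsetIr _ _)) _;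
     rewrite (card_emb femb); lia.
case/card_gt0P=> y; rewrite inE => /andP[yim yA].
have yp : y \notin map f [:: a, c & rest] by apply: contra yim => /pim[].
have [||p' hp'] := @insert_near_clique _ B (f a) (map f (c :: rest)) un so y yp d.
- apply: leq_trans (degA y yA); apply/subset_leq_card/subsetP=> z.
  by rewrite !in_nbh inE => /andP[/pim[-> _] ->].
- by rewrite size_map; move: szys => /=; lia.
exact: emb_longer S femb yA yim hp'.
Qed.

(** Either some free vertex lengthens the embedded path, or the free vertices [F] span no [t]
    disjoint blue edges. In the second case [F] contains a near red clique on at least [n] vertices,
    which hosts [X] afresh. *)
Lemma path_step G X a b c rest U f n q k t :
  0 < t -> suspended G X [:: a, b, c & rest] ->
  8 * t <= size [:: a, b, c & rest] + 6 ->
  3 * (t * k) + 4 * t <= size [:: a, b, c & rest] + 2 ->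
  degsum G X <= q -> #|X| <= n -> n + #|X| + t <= #|U| + 2 ->
  (forall j e, e <= j -> j * e <= q -> e <= 2 \/ j + (2 * t - 2) * e < n) ->
  ~ packs B k t setT ->
  is_emb (compl B) (short G a c) (X :\ b) U f ->
  exists f', is_emb (compl B) G X U f'.
Proof.
move=> t0 S sz1 sz2 degX Xn Un room np femb.
have [un so pim] := emb_path (suspended_short S) femb.
set F := U :\: f @: (X :\ b).
have bX : b \in X by have [_ sub _ _] := S; apply: sub; rewrite !inE eqxx orbT.
have cX := cardsD1 b X; rewrite bX in cX.
have cF : #|U| < #|F| + #|X|.
  have := cardsID (f @: (X :\ b)) U; have := subset_leq_card (subsetIr U (f @: (X :\ b))).
  by rewrite (card_emb femb) -/F; lia.
have Fp y : y \in F -> y \notin map f [:: a, c & rest].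
  by rewrite inE => /andP[yim _]; apply: contra yim => /pim[].
case: (classic (exists y p', y \in F /\ longer (compl B) (map f [:: a, c & rest]) y p')).
  by move=> [y [p' [+ hp']]]; rewrite inE => /andP[yim yU]; apply: emb_longer S femb yU yim hp'.
move=> stuck; set P := [set z in belast (f a) (map f (c :: rest))].
have cP : #|P| = (size rest).+1 by rewrite card_front //= size_map.
have red y : y \in F -> (#|nbh (compl B) P y|).+1 < t * k.+2.
  move=> yF; apply: (few_red_neighbours un so (Fp y yF)) np => p' hp'.
  by apply: stuck; exists y, p'.
have Pp z : z \in P -> z \in map f [:: a, c & rest].
  have -> : map f [:: a, c & rest] = _ := lastI (f a) (map f (c :: rest)).
  by rewrite inE mem_rcons inE => ->; rewrite orbT.
(* A free vertex is red to at most [t * k + 2 * t - 2] vertices of [P], so any two of them have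
   [t * k] common blue neighbours there: enough pages for [t] books. *)
have nm : ~ matching B t F.
  move=> mF; apply: np; apply: (@packs_sub _ _ _ _ (F :|: P)) (subsetT _) _.
  apply: pack_pool mF _.
    by apply/pred0P=> z /=; apply/negbTE/negP=> /andP[/Fp/negP + /Pp].
  move=> u v uF vF _.
  have cov : P \subset (nbh B P u :&: nbh B P v) :|: (nbh (compl B) P u :|: nbh (compl B) P v).
    apply/subsetP=> z zP; have nz y : y \in F -> y != z.
      by move/Fp; apply: contraNneq => ->; apply: Pp.
    rewrite !in_setU in_setI !in_nbh zP /= /compl_rel /= !nz //=.
    by case: (adj B u z); case: (adj B v z).
  have := subset_leq_card cov; rewrite cP.
  have := red u uF; have := red v vF; move: sz2 => /=.
  have := cardsU (nbh (compl B) P u) (nbh (compl B) P v).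
  have := cardsU (nbh B P u :&: nbh B P v) (nbh (compl B) P u :|: nbh (compl B) P v).
  have -> : t * k.+2 = t * k + 2 * t by lia.
  move: (t * k) => tk; lia.
have [A [AF cA degA]] := no_matching t0 nm.
have AU : A \subset U by apply: subset_trans AF (subsetDl _ _).
(* With [d = 2 * t - 2], shortening [2 * d] times yields the whole slack, even if [#|A|] is just
   [#|X|]. *)
have [||||f' f'emb] := @near_clique_path (2 * (2 * t - 2)) G X _ A (2 * t - 2) n q S _ degX _ _ _ degA room.
- by lia.
- by lia.
- by lia.
- by lia.
by exists f'; apply: is_embS f'emb.
Qed.
End PathStep.

(** * Existence of long suspended paths *)

Section Layers.
Variables (V : finType) (G : sgraph V) (X T : {set V}).
Hypothesis TX : T \subset X.
Hypothesis deg2 : forall x, x \in X -> x \notin T -> #|nbh G X x| = 2.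

(** The vertices at distance at most [j] from [T] in the subgraph induced on [X]. *)
Fixpoint ball j : {set V} :=
  if j is j'.+1 then ball j' :|: [set v in X | [exists u in ball j', adj G u v]] else T.

(** Note the shift: these are the vertices at distance exactly [j + 1]. *)
Definition layer j := ball j.+1 :\: ball j.

Lemma ball_sub j : ball j \subset X.
Proof.
elim: j => //= j IH; rewrite subUset IH; apply/subsetP=> v.
by rewrite inE => /andP[].
Qed.

Lemma ballS j : ball j \subset ball j.+1. Proof. exact: subsetUl. Qed.

Lemma sub_ball j : T \subset ball j.
Proof. by elim: j => //= j IH; apply: subset_trans (subsetUl _ _). Qed.

Lemma layerP j v : v \in layer j ->
  [/\ v \in X, v \notin T, v \notin ball j, v \in ball j.+1 & exists2 u, u \in ball j & adj G u v].
Proof.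
move=> vl; have := vl; rewrite !inE => /andP[vb].
rewrite (negbTE vb) /= => /andP[vX /exists_inP[u ub uv]].
split=> //; last by exists u.
  by apply: contra vb; apply: (subsetP (sub_ball j)).
by rewrite vX; apply/exists_inP; exists u.
Qed.

Lemma layer_prev j v : v \in layer j.+1 -> exists2 u, u \in layer j & adj G u v.
Proof.
case/layerP=> vX _ vb _ [u ub uv]; exists u; rewrite // inE ub andbT.
apply: contra vb => ub'; rewrite !inE vX; apply/orP; right.
by apply/exists_inP; exists u.
Qed.

(** A vertex of a layer has degree 2 and a neighbour closer to [T], so at most one neighbour in the
    next layer: the map [g] to predecessors is injective. *)
Lemma card_layerS j : #|layer j.+1| <= #|layer j|.
Proof.
pose g v := odflt v [pick u in layer j | adj G u v].
have gP v : v \in layer j.+1 -> g v \in layer j /\ adj G (g v) v.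
  move=> /layer_prev[u ul uv]; rewrite /g; case: pickP => [w /andP[]//|/(_ u)].
  by rewrite /= ul uv.
rewrite -(card_in_imset (f := g)).
  by apply/subset_leq_card/subsetP=> _ /imsetP[v /gP[+ _] ->].
move=> v v' vl v'l egv; apply/eqP; apply: contraT => nvv'.
have [gl gv] := gP v vl; have [_ gv'] := gP v' v'l; rewrite -egv in gv'.
have [gX gT _ _ [w wb wg]] := layerP gl.
have [vX _ vb _ _] := layerP vl; have [v'X _ v'b _ _] := layerP v'l.
have wb' : w \in ball j.+1 by apply: (subsetP (ballS j)).
have : [set v; v'; w] \subset nbh G X (g v).
  rewrite !subUset !sub1set !in_nbh vX v'X gv gv' (subsetP (ball_sub j)) //=.
  by rewrite adj_sym.
move/subset_leq_card; rewrite (deg2 gX gT) setUC cardsU1 cards2 nvv' !inE negb_or.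
have wv : w != v by apply/eqP=> e; rewrite -e wb' in vb.
have wv' : w != v' by apply/eqP=> e; rewrite -e wb' in v'b.
by rewrite wv wv'.
Qed.

Lemma card_ball j : #|ball j| <= #|T| + j * \sum_(x in T) #|nbh G X x|.
Proof.
have l0 : #|layer 0| <= \sum_(x in T) #|nbh G X x|.
  apply: leq_trans (leq_card_bigcup T (nbh G X)).
  apply/subset_leq_card/subsetP=> v /layerP[vX _ _ _ [u uT uv]].
  by apply/bigcupP; exists u; rewrite // in_nbh vX.
have lj i : #|layer i| <= \sum_(x in T) #|nbh G X x|.
  by elim: i => // i IH; apply: leq_trans (card_layerS i) IH.
elim: j => [|j IH]; first by rewrite mul0n addn0.
have := cardsID (ball j) (ball j.+1); rewrite (setIidPr (ballS j)) -/(layer j) => <-.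
by rewrite mulSn addnA [_ + \sum_(_ in _) _]addnC -addnA addnC; apply: leq_add.
Qed.

(** Descending layer by layer leads from [v] to [T], which is met only at the last vertex. *)
Lemma layer_path j v : v \in layer j -> exists ys, [/\ uniq (v :: ys),
  size ys = j.+1, {subset v :: ys <= ball j.+1}, path (adj G) v ys &
  forall s1 a b c s2, v :: ys = s1 ++ [:: a, b, c & s2] -> b \notin T].
Proof.
elim: j v => [|j IH] v vl.
  have [vX vT vb vb1 [u ub uv]] := layerP vl; exists [:: u]; split=> //=.
  - by rewrite inE andbT; apply: contraNneq vT => ->.
  - move=> x; rewrite !inE => /orP[/eqP->|/eqP->]; last by rewrite ub.
    by move: vb1; rewrite !inE.
  - by rewrite adj_sym uv.
  - by move=> s1 a b c s2 /(congr1 size); rewrite size_cat /=; lia.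
have [u ul uv] := layer_prev vl; have [us [uu su sub pu hint]] := IH u ul.
have [_ _ vb vb1 _] := layerP vl; exists (u :: us); split=> //.
- by rewrite cons_uniq uu andbT; apply: contra vb; apply: sub.
- by rewrite /= su.
- by move=> x; rewrite inE => /orP[/eqP->//|/sub]; apply: (subsetP (ballS _)).
- by rewrite /= adj_sym uv.
- move=> [|x s1] a b c s2 /= [_].
    by move=> [<- _]; case: (layerP ul).
  exact: hint.
Qed.

(** The ball of radius [r] is too small to be [X], so by connectedness [layer r] is nonempty. *)
Lemma layers_path r : T != set0 -> conn G X ->
  #|T| + r * \sum_(x in T) #|nbh G X x| < #|X| ->
  exists ys, [/\ uniq ys, size ys = r.+2, {subset ys <= X}, sorted (adj G) ys &
    forall s1 a b c s2, ys = s1 ++ [:: a, b, c & s2] -> b \notin T].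
Proof.
move=> T0 cX lt; have [||y [z [yb zX zb yz]]] := cX (ball r) (ball_sub r).
- by apply: contraNneq T0 => e; rewrite -subset0 -e sub_ball.
- by apply/eqP=> e; have := card_ball r; rewrite e leqNgt lt.
have zl : z \in layer r.
  by rewrite !inE (negbTE zb) zX /=; apply/exists_inP; exists y.
have [ys [un sz sub pa hint]] := layer_path zl.
exists (z :: ys); split=> //; first by rewrite /= sz.
by move=> x /sub; apply: (subsetP (ball_sub _)).
Qed.
End Layers.

(* Counting degrees, a graph with few edges in excess of its vertices has few
   vertices of degree at least 3, hence long stretches of vertices of degree 2. *)
Lemma long_path (V : finType) (G : sgraph V) (X E : {set V}) l r :
  conn G X -> E \subset X -> E != set0 ->
  (forall x, x \in X -> x \notin E -> 2 <= #|nbh G X x|) ->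
  degsum G X <= 2 * #|X| + 2 * l ->
  r.+1 * (6 * l + 6 * #|E|) < #|X| ->
  exists ys, [/\ uniq ys, size ys = r.+2, {subset ys <= X}, sorted (adj G) ys &
    forall s1 a b c s2, ys = s1 ++ [:: a, b, c & s2] -> b \notin E /\ #|nbh G X b| = 2].
Proof.
move=> cX EX E0 deg degX lt.
pose T := [set x in X | (x \in E) || (#|nbh G X x| != 2)].
have TX : T \subset X by apply/subsetP=> x; rewrite inE => /andP[].
have ET : E \subset T by apply/subsetP=> x xE; rewrite inE xE (subsetP EX).
have deg2 x : x \in X -> x \notin T -> #|nbh G X x| = 2.
  by move=> xX; rewrite inE xX negb_or negbK => /andP[_ /eqP].
have sumT : degsum G X = \sum_(x in T) #|nbh G X x| + 2 * #|X :\: T|.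
  rewrite /degsum (big_setID T) /= (setIidPr TX); congr (_ + _).
  rewrite (eq_bigr (fun=> 2)) ?sum_nat_const 1?mulnC // => x.
  by rewrite inE => /andP[xT xX]; apply: deg2.
have cXT := cardsID T X; rewrite (setIidPr TX) in cXT.
have cTE := cardsID E T; rewrite (setIidPr ET) in cTE.
have sumE : 3 * #|T :\: E| <= \sum_(x in T) #|nbh G X x|.
  rewrite (big_setID E) /= (setIidPr ET) mulnC -sum_nat_const.
  apply: leq_trans (leq_addl _ _); apply: leq_sum => x.
  rewrite !inE => /and3P[xE xX]; rewrite (negbTE xE) /= => ne.
  by have := deg x xX xE; lia.
have [||ys [un sz sub so hint]] := @layers_path V G X T TX deg2 r _ cX.
- by apply: contraNneq E0 => e; rewrite -subset0 -e.
(* The degrees over [T] sum to at most [2 * #|T| + 2 * l] and at least [3 * #|T| - 3 * #|E|]; hence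
   [#|T| <= 2 * l + 3 * #|E|], and the sum is at most [6 * l + 6 * #|E|]. *)
- have hT : #|T| <= 6 * l + 6 * #|E| by lia.
  have hS : \sum_(x in T) #|nbh G X x| <= 6 * l + 6 * #|E| by lia.
  by apply: leq_ltn_trans lt; rewrite mulSn leq_add // leq_mul2l hS orbT.
exists ys; split=> // s1 a b c s2 e; have bT := hint _ _ _ _ _ e.
have bX : b \in X by apply: sub; rewrite e mem_cat !inE eqxx !orbT.
by split; [apply: contra bT; apply: (subsetP ET)|apply: deg2].
Qed.

Lemma suspended_deg2 (V : finType) (G : sgraph V) (X : {set V}) ys :
  uniq ys -> {subset ys <= X} -> sorted (adj G) ys ->
  (forall s1 a b c s2, ys = s1 ++ [:: a, b, c & s2] -> #|nbh G X b| = 2) ->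
  suspended G X ys.
Proof.
move=> un sub so deg2; split=> // s1 a b c s2 e v vX bv.
have [aX cX] : a \in X /\ c \in X by split; apply: sub; rewrite e mem_cat !inE eqxx !orbT.
have [ab bc nac] : [/\ adj G a b, adj G b c & a != c].
  move: so un; rewrite e cat_uniq => + /and3P[_ _ /=]; rewrite !inE !negb_or.
  move=> + /andP[/and3P[_ -> _] _]; case: (s1) => [|z s1'] /=.
    by case/and3P.
  by rewrite cat_path /= => /and5P[_ _ -> ->].
have : nbh G X b = [set a; c].
  apply/eqP; rewrite eq_sym eqEcard (deg2 _ _ _ _ _ e) cards2 nac andbT.
  by rewrite subUset !sub1set !in_nbh aX cX adj_sym ab bc.
by move/setP/(_ v); rewrite in_nbh vX bv !inE => /esym/orP[/eqP|/eqP]; [left|right].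
Qed.

(** * The upper bound *)

(** Equality holds at [y = 2]; this converts the cubic lower bound on [n] into a quadratic one in
    [x - 1]. *)
Lemma cube_bound y : 27 * (y * y) <= 4 * (y.+1 * y.+1 * y.+1).
Proof.
case: y => [|[|z]] //.
have -> : 4 * (z.+3 * z.+3 * z.+3) = 27 * (z.+2 * z.+2) + 4 * (z * z * z) + 9 * (z * z) by lia.
by rewrite -addnA leq_addr.
Qed.

Section UpperBound.
Variables (k t n l : nat).
Hypothesis k_gt0 : 0 < k.
Hypothesis t_gt0 : 0 < t.
Let x := t * k.
Hypothesis n_large : 111 * (x * x * x) <= n.
Hypothesis l_small : l * (127 * (x * x) + 79 * x) <= n.
(* [q] bounds the degree sum; [c] is the excess allowed in blue degrees. *)
Let q := 2 * n + 2 * l.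
Let c := t.-1 * k.+2 + 2 * k.-1.

(** * Numerical estimates *)

Lemma x_gt0 : 0 < x. Proof. by rewrite muln_gt0 t_gt0. Qed.
Lemma tx : t <= x. Proof. by rewrite leq_pmulr. Qed.
Lemma kx : k <= x. Proof. by rewrite leq_pmull. Qed.
Lemma tkx : t + k <= x + 1. Proof. by rewrite /x; nia. Qed.
Lemma seedsE : t.-1 * k.+2 + k + 2 = x + 2 * t. Proof. by rewrite /x; nia. Qed.

Lemma n_111 : 111 * x <= n.
Proof. by apply: leq_trans n_large; have := x_gt0; nia. Qed.

Lemma l_206 : 206 * l <= n.
Proof. by apply: leq_trans l_small; have := x_gt0; nia. Qed.

(** For [e >= 3], [j * e <= q] keeps [j] near [2 * n / 3], and [e * e <= q] keeps [e] near the
    square root of [2 * n], so that [d * e <= n / 8]. *)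
Lemma few_large_degrees d : d <= 2 * x - 2 ->
  forall j e, e <= j -> j * e <= q -> e <= 2 \/ 5 * (j + d * e) <= 4 * n.
Proof.
move=> dx j e ej jq; case: (leqP e 2) => e3; [by left|right].
have lj : 309 * j <= 207 * n.
  have := l_206; have : 3 * j <= q by apply: leq_trans jq; rewrite mulnC leq_mul2l e3 orbT.
  by rewrite /q; lia.
have le : 103 * (e * e) <= 207 * n.
  have : e * e <= q by apply: leq_trans jq; rewrite leq_mul2r ej orbT.
  by have := l_206; rewrite /q; lia.
have [y ey] : exists y, x = y.+1 by exists x.-1; rewrite prednK // x_gt0.
have ny : 2997 * (y * y) <= 4 * n.
  apply: leq_trans (leq_mul (leqnn 4) n_large); rewrite ey.
  by have := cube_bound y; move: (y * y) (y.+1 * y.+1 * y.+1) => y2 y3; clear; lia.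
have dy : d <= 2 * y by lia.
(* Squaring turns this into the product of the bounds on [y * y] and [e * e]. *)
have lm : 16 * (y * e) <= n.
  rewrite -leq_sqr -!mulnn.
  have h1 : 700 * (y * y) * (3 * (e * e)) <= n * (7 * n).
    by apply: leq_mul; [move: (y * y) ny | move: (e * e) le] => ?; clear; lia.
  have -> : 16 * (y * e) * (16 * (y * e)) = 256 * ((y * y) * (e * e)) by clear; lia.
  have : 2100 * ((y * y) * (e * e)) <= 7 * (n * n) by move: h1; clear; lia.
  by move: ((y * y) * (e * e)) (n * n) => ? ?; clear; lia.
have : d * e <= 2 * (y * e) by rewrite mulnA leq_mul2r dy orbT.
move: (d * e) (y * e) lm => de ye lm; lia.
Qed.

(** The room required by [base_embedding] on [m] vertices inside [2 * n - 1] vertices from which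
    [t - 1] books are deleted. *)
Lemma base_room m : m <= (3 * x + 5 * t - 4) * (6 * l + 6) ->
  m + k * (2 * m + 2 * l) + t.-1 * k.+2 + 1 < 2 * n.
Proof.
move=> lm; have tx := tx; have x0 := x_gt0; have kx := kx.
have l1 : 127 * (x * x * l) + 79 * (x * l) <= n by apply: leq_trans l_small; lia.
have l2 : 111 * (x * x) <= n by apply: leq_trans n_large; rewrite leq_mul2l leq_pmulr // x0 orbT.
have h1 : m <= (8 * x - 4) * (6 * l + 6).
  by apply: leq_trans lm _; rewrite leq_mul2r; apply/orP; right; lia.
have h2 : m * (2 * x + 1) <= (8 * x - 4) * (6 * l + 6) * (2 * x + 1) by rewrite leq_mul2r h1 orbT.
have h3 : (8 * x - 4) * (2 * x + 1) + 4 = 16 * (x * x).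
  rewrite -(prednK x0) (_ : 8 * x.-1.+1 - 4 = 8 * x.-1 + 4); last by lia.
  by move: x.-1 => y; clear; lia.
have h4 : m * (2 * x + 1) + 24 * (l + 1) <= 96 * (x * x * l) + 96 * (x * x).
  apply: leq_trans (_ : ((8 * x - 4) * (2 * x + 1) + 4) * (6 * l + 6) <= _); last by rewrite h3; lia.
  by rewrite mulnDl mulnAC; lia.
have h5 : k * (2 * m + 2 * l) <= x * (2 * m + 2 * l) by rewrite leq_mul2r kx orbT.
have := seedsE.
have h6 : x * (2 * m + 2 * l) = m * (2 * x) + 2 * (x * l) by clear; lia.
have h7 : m * (2 * x + 1) = m * (2 * x) + m by clear; lia.
have h8 : x <= x * x by rewrite leq_pmulr.
move: h4 h5 l1 l2 h8; rewrite h6 h7.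
move: (m * (2 * x)) (x * x * l) (x * l) (k * _) (t.-1 * k.+2) (x * x) => A1 A2 A3 A4 A5 A6.
move: x0 tx kx k_gt0; clear; lia.
Qed.

Lemma c_bounds : t <= c + 1 /\ c + 4 <= 4 * x.
Proof. by rewrite /c /x; split; nia. Qed.

Lemma cE : c + 4 = x + 2 * t + k.
Proof.
have := seedsE; rewrite /c; move: (t.-1 * _) => a; move: k_gt0; clear; lia.
Qed.

(** The first product is the hypothesis of [long_path] with [e] exceptional vertices; the second
    bounds the number of leaves when at most [4 * x - 4] vertices carry at most [24 * x] leaves
    each. *)
Lemma path_room e : e <= 4 * x - 3 ->
  (3 * x + 5 * t + c - 5) * (6 * l + 6 * e) + (4 * x - 4) * (24 * x) < n.
Proof.
move=> le; have tx := tx; have x0 := x_gt0; have tkx := tkx; have cE := cE.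
have h1 : 3 * x + 5 * t + c - 5 <= 11 * x - 8 by lia.
have h2 : 6 * l + 6 * e <= 6 * l + 6 * (4 * x - 3) by lia.
apply: leq_ltn_trans (leq_add (leq_mul h1 h2) (leqnn _)) _.
move: n_large l_small; clear - x0; case: (x) x0 => // y _.
have -> : 11 * y.+1 - 8 = 11 * y + 3 by lia.
have -> : 4 * y.+1 - 3 = 4 * y + 1 by lia.
have -> : 4 * y.+1 - 4 = 4 * y by lia.
by case: y => [|[|[|z]]]; lia.
Qed.

Variables (W : finType) (B : sgraph W).
Hypothesis no_books : ~ packs B k t setT.
Implicit Types (A U : {set W}).

Section Hosts.
Variable V : finType.
Implicit Types (G : sgraph V) (X : {set V}).

(** For minimum degrees up to 2 the [2 * k.-1] extra vertices suffice; larger ones fall under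
    [few_large_degrees]. *)
Lemma embed_large G X A : #|X| <= n -> degsum G X <= q -> n + 2 * k.-1 <= #|A| ->
  (forall a, a \in A -> #|nbh B A a| < k) -> exists f, is_emb (compl B) G X A f.
Proof.
move=> Xn degX cA degA.
have n0 : 0 < n by apply: leq_trans n_111; rewrite muln_gt0 x_gt0.
apply: (@near_clique _ _ _ _ _ _ k.-1 q) degX _ => [|a /degA|j e /andP[_ jX] ej jq].
- by lia.
- by lia.
have [|e2|] := @few_large_degrees k.-1 _ j e ej jq; first by have := kx; lia.
  have : k.-1 * e <= k.-1 * 2 by rewrite leq_mul2l e2 orbT.
  by move: (k.-1 * e) => ke; lia.
by move: (k.-1 * e) => ke; lia.
Qed.

(** Induction on [#|X|]. A vertex of degree at most 1 is removed and reattached. If all degrees are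
    at least 2, a large [X] has a suspended path to shorten, and a small one is embedded in a
    book-free part of [U]. *)
Lemma embed_sparse U : 2 * n <= #|U| + 1 ->
  (forall p, p \in U -> #|nbh B setT p| < n + c) ->
  forall G X, conn G X -> degsum G X <= 2 * #|X| + 2 * l -> #|X| + c <= n ->
  exists f, is_emb (compl B) G X U f.
Proof.
move=> cU degU G X; have [m] := ubnP #|X|; elim: m G X => // m IH G X; rewrite ltnS => leX cX degX Xn.
have n0 : 0 < n by apply: leq_trans n_111; rewrite muln_gt0 x_gt0.
have /card_gt0P[z0 z0U] : 0 < #|U| by lia.
have [tc _] := c_bounds.
case: (set_0Vmem X) => [->|[v0 v0X]].
  by exists (fun=> z0); split=> [u v|u|u v]; rewrite inE.
case: (boolP [exists v in X, #|nbh G X v| <= 1]) => [/exists_inP[v vX dv]|/exists_inPn degge2].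
  have cXv := cardsD1 v X; rewrite vX in cXv.
  have [N0|[u uN]] := set_0Vmem (nbh G X v).
    have eX : X = [set v].
      apply/eqP; apply: contraT => ne; have [||| y [z []]] := cX [set v].
      - by rewrite sub1set.
      - by apply/set0Pn; exists v; rewrite inE.
      - by rewrite eq_sym.
      by rewrite inE => /eqP-> zX _ vz; have := in_set0 z; rewrite -N0 in_nbh zX vz.
    exists (fun=> z0); rewrite eX; split=> [a b|//|a b].
      by rewrite !inE => /eqP-> /eqP->.
    by rewrite !inE => /eqP-> /eqP->; rewrite adj_irr.
  have eN : nbh G X v = [set u].
    by apply/eqP; rewrite eq_sym eqEcard sub1set uN cards1.
  have := uN; rewrite in_nbh => /andP[uX vu].
  have uv : u != v by apply: contraTneq vu => ->; rewrite adj_irr.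
  have [||||f femb] := IH G (X :\ v).
  - by lia.
  - apply: conn_leaves => // [|w]; first by rewrite sub1set.
    by rewrite inE => /eqP->; exists u; rewrite // !inE uv.
  - by have := degsum_rem vX uX vu; lia.
  - by lia.
  have [fi fU fe] := femb; have uXv : u \in X :\ v by rewrite !inE uv.
  (* At most [n - c - 1] vertices are used and at most [n + c - 1] are blue to [f u], out of at
     least [2 * n - 1]. *)
  have : 0 < #|U :\: (f @: (X :\ v) :|: nbh B setT (f u))|.
    have := cardsID (f @: (X :\ v) :|: nbh B setT (f u)) U.
    have := subset_leq_card (subsetIr U (f @: (X :\ v) :|: nbh B setT (f u))).
    have := cardsU (f @: (X :\ v)) (nbh B setT (f u)).
    have := degU _ (fU u uXv); rewrite (card_emb femb); lia.
  case/card_gt0P=> z; rewrite !inE negb_or => /andP[/andP[zim zN] zU].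
  exists (fun w => if w \in [set v] then z else f w).
  apply: (emb_indep (L := [set v]) femb) => [a b|a _|a b].
  - by rewrite !inE => /eqP-> /eqP->.
  - by rewrite zU zim.
  - rewrite !inE => /eqP-> bX vb; have : b \in nbh G X v by rewrite in_nbh bX.
    rewrite eN inE => /eqP->; split=> //; rewrite /= /compl_rel /=.
    by rewrite zN andbT; apply: contraNneq zim => <-; rewrite imset_f.
(* The threshold is the one at which [long_path] yields a path of [3 * x + 5 * t - 3] vertices, long
   enough for [path_step]. *)
case: (leqP #|X| ((3 * x + 5 * t - 4) * (6 * l + 6))) => sz.
  have [|U' [cU' free]] := @packing_free _ B k t.-1 U.
    by rewrite prednK // => pU; apply: no_books; apply: packs_sub pU; apply: subsetT.
  have room := base_room sz.
  have cA : #|U| <= #|U :\: U'| + #|U'|.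
    by have := cardsID U' U; have := subset_leq_card (subsetIr U U'); lia.
  have [|||f femb] := @base_embedding _ _ B G X (U :\: U') k (2 * #|X| + 2 * l) _ _ degX.
  - by move: room cU' cA cU; move: (t.-1 * k.+2) (k * _) => a b; lia.
  - by move=> a b; apply: book_free_nbh.
  - by move: room cU' cA cU; move: (t.-1 * k.+2) (k * _) => a b; lia.
  by exists f; apply: is_embS femb => //; apply: subsetDl.
have t4 : 4 < 3 * x + 5 * t by have := x_gt0; lia.
(* The exceptional set must be nonempty; an arbitrary vertex [v0] fills it. *)
have [||||ys [un sy sub so hint]] := @long_path _ G X [set v0] l (3 * x + 5 * t - 5) cX _ _ _ degX.
- by rewrite sub1set.
- by apply/set0Pn; exists v0; rewrite inE.
- by move=> v vX _; have := degge2 v vX; lia.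
- by rewrite cards1 muln1 (_ : (_ - 5).+1 = 3 * x + 5 * t - 4) //; lia.
have S : suspended G X ys.
  by apply: suspended_deg2 => // s1 a b d s2 /hint[].
have [|a [b [d [rest eys]]]] := suspended_size3 S; first by rewrite sy; have := x_gt0; lia.
rewrite {}eys in S sy.
have bX : b \in X by have [_ sub' _ _] := S; apply: sub'; rewrite !inE eqxx orbT.
have cXb := cardsD1 b X; rewrite bX in cXb.
have dS := degsum_short S.
have [||||f femb] := IH (short G a d) (X :\ b).
- by lia.
- exact: conn_short S cX.
- by lia.
- by lia.
have tx := tx.
apply: (@path_step _ _ B G X a b d rest U f n q k t) => //.
- by move: sy; rewrite -/x /=; lia.
- by move: sy; rewrite -/x /=; lia.
- by rewrite /q; lia.
- by lia.
- by lia.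
- move=> j e ej jq; have [|e2|] := @few_large_degrees (2 * t - 2) _ j e ej jq; first by lia.
    by left.
  by move: (_ * e) => de; lia.
Qed.
End Hosts.

(** * A colouring without blue books and without a red copy of [G] *)

Section Final.
Variables (V : finType) (G : sgraph V).
Hypothesis card_V : #|V| = n.
Hypothesis card_W : #|W| + 2 = 2 * n + t.
Hypothesis conn_G : conn G setT.
Hypothesis deg_G : degsum G setT <= q.
Hypothesis no_red : forall f, ~ is_emb (compl B) G setT setT f.

Lemma n_gt0 : 0 < n.
Proof. by apply: leq_trans n_111; rewrite muln_gt0 x_gt0. Qed.

(** If every vertex of a [t]-set kept a blue star in its blue neighbourhood after any small
    deletion, [stars_pack] would give [t] books. *)
Lemma star_free_nbh (Y : {set W}) : t <= #|Y| -> exists p U,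
  [/\ p \in Y, #|U| <= t.-1 * k.+2 &
   forall a, a \in nbh B setT p :\: U -> #|nbh B (nbh B setT p :\: U) a| < k].
Proof.
move=> /subset_card_exists[C CY cC]; apply: NNPP => none; apply: no_books.
apply: (stars_pack cC) => p U pC leU; apply: NNPP => nostar; apply: none.
exists p, U; split=> //; first exact: (subsetP CY).
by move=> a aA; rewrite ltnNge; apply/negP => le; apply: nostar; exists a.
Qed.

Definition low : {set W} := [set p | #|nbh B setT p| < n + c].

(** Given [t] vertices of larger blue degree, one has a star-free blue neighbourhood after deleting
    [(t - 1) * (k + 2)] vertices. By the choice of [c], [n + 2 * k.-1] vertices remain, and
    [embed_large] places [G] there. *)
Lemma card_low : 2 * n <= #|low| + 1.
Proof.
have := cardsC low; rewrite -(addn2 _) => eW.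
case: (leqP t #|~: low|) => [/star_free_nbh|lt]; last by have := card_W; lia.
case=> p [U [ph leU degA]]; exfalso.
have [||f femb] := @embed_large V G setT (nbh B setT p :\: U) _ deg_G _ degA.
- by rewrite cardsT card_V.
- have := cardsID U (nbh B setT p); have := subset_leq_card (subsetIr (nbh B setT p) U).
  move: ph; rewrite !inE -leqNgt /c; move: (t.-1 * k.+2) leU => a; lia.
- by apply: (no_red (is_embS (subxx _) (subsetT _) femb)).
Qed.

Definition is_leaf v := #|nbh G setT v| == 1.
(** Meant for leaves, where it is the only neighbour; the default occurs only when there is none. *)
Definition att v := odflt v [pick u in nbh G setT v].

Lemma attP v : is_leaf v -> nbh G setT v = [set att v].
Proof.
move=> /cards1P[u eu]; rewrite /att; case: pickP => [w|/(_ u)]; rewrite eu inE ?eqxx //.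
by move/eqP->.
Qed.

Lemma adj_att v : is_leaf v -> adj G v (att v).
Proof.
move=> /attP e; have : att v \in nbh G setT v by rewrite e inE.
by rewrite in_nbh => /andP[].
Qed.

(** Hall's theorem assigns distinct free vertices of [S] to the leaves, each red to the image of the
    leaf's neighbour. *)
Lemma attach_leaves (L : {set V}) (A S : {set W}) f :
  (forall v, v \in L -> is_leaf v /\ att v \notin L) ->
  is_emb (compl B) G (setT :\: L) A f -> S \subset A :\: f @: (setT :\: L) ->
  (forall C : {set V}, C \subset L ->
    #|C| <= #|related (fun v s => (s \in S) && adj (compl B) (f (att v)) s) C|) ->
  exists f', is_emb (compl B) G setT A f'.
Proof.
move=> leafL femb SA hallS.
have [w0 _] : exists w0 : W, w0 \in [set: W].
  by apply/card_gt0P; rewrite cardsT; have := card_W; have := n_gt0; lia.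
have [g [gi gr]] := hall w0 hallS.
exists (fun v => if v \in L then g v else f v).
apply: (emb_indep femb gi) => [v vL|v u vL _ vu].
  have /andP[gS _] := gr v vL; have := subsetP SA _ gS.
  by rewrite inE => /andP[-> ->].
have [lv avL] := leafL v vL; have /andP[_ fg] := gr v vL.
have : u \in nbh G setT v by rewrite in_nbh inE.
by rewrite (attP lv) inE => /eqP->.
Qed.

(** Deleting [c] or more leaves brings the order down to [n - c], as [embed_sparse] requires. *)
Lemma embed_without_leaves (L : {set V}) (U : {set W}) :
  (forall v, v \in L -> is_leaf v /\ att v \notin L) -> c <= #|L| ->
  2 * n <= #|U| + 1 -> (forall p, p \in U -> #|nbh B setT p| < n + c) ->
  exists f, is_emb (compl B) G (setT :\: L) U f.
Proof.
move=> leafL cL cU degU; have cX := cardsID L setT; rewrite (setIidPr (subsetT L)) cardsT card_V in cX.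
apply: (embed_sparse cU degU).
- apply: conn_leaves (subsetT _) _ conn_G => v /leafL[lv av].
  by exists (att v); rewrite ?(attP lv) // !inE av.
- have := @degsum_leaves _ G setT L (subsetT _) _; move: deg_G; rewrite /q.
  suff h : forall v, v \in L -> exists2 u, u \in setT :\: L & adj G v u.
    by move=> d /(_ h); lia.
  by move=> v /leafL[lv av]; exists (att v); rewrite ?adj_att // !inE av.
- by lia.
Qed.

Lemma no_leaf_matching (L : {set V}) :
  (forall v, v \in L -> is_leaf v /\ att v \notin L) -> {in L &, injective att} ->
  4 * x <= #|L| + 3 -> False.
Proof.
move=> leafL att_inj cL.
have [tc c4] := c_bounds; have tkx := tkx; have tx := tx; have x0 := x_gt0.
have cE := cE.
have cX := cardsID L setT; rewrite (setIidPr (subsetT L)) cardsT card_V in cX.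
have [||f femb] := embed_without_leaves leafL _ card_low.
- by lia.
- by move=> p; rewrite inE.
have [fi fU fe] := femb.
set X := setT :\: L in cX femb fi fU fe.
have attX v : v \in L -> att v \in X by case/leafL=> _ av; rewrite !inE av.
pose S := ~: (f @: X).
have cS : #|S| + #|X| = #|W|.
  by have := cardsC (f @: X); rewrite (card_emb femb) -/S; lia.
pose rel v s := (s \in S) && adj (compl B) (f (att v)) s.
(* If Hall's condition held, the leaves would complete a red copy of [G]. *)
have [C [CL ltC]] : exists C : {set V}, C \subset L /\ #|related rel C| < #|C|.
  apply: NNPP => none.
  have [||f' f'emb] := @attach_leaves L setT S f leafL (is_embS (subxx _) (subsetT _) femb).
  - by rewrite setTD.
  - by move=> C CL; rewrite leqNgt; apply/negP => lt; apply: none; exists C.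
  exact: no_red f'emb.
set S' := S :\: related rel C; set P := (fun v => f (att v)) @: C.
have cP : #|P| = #|C|.
  rewrite card_in_imset // => u v /(subsetP CL) uL /(subsetP CL) vL /fi e.
  by apply: att_inj => //; apply: e; apply: attX.
have PX p : p \in P -> p \in f @: X.
  by case/imsetP=> v /(subsetP CL) vL ->; apply: imset_f; apply: attX.
have blue p s : p \in P -> s \in S' -> adj B p s.
  case/imsetP=> v vC -> {p}; rewrite !inE => /andP[nr sS].
  apply: contraNT nr => nB; apply/exists_inP; exists v => //.
  rewrite /rel inE sS /= /compl_rel /= nB andbT.
  by apply: contraNneq sS => <-; apply: imset_f; apply/attX/(subsetP CL).
have cS' : #|S| < #|S'| + #|C|.
  have := cardsID (related rel C) S; have := subset_leq_card (subsetIr S (related rel C)).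
  by rewrite -/S'; lia.
have [v0 v0C] : exists v0, v0 \in C by apply/card_gt0P; apply: leq_ltn_trans ltC.
have v0P : f (att v0) \in P by apply/imsetP; exists v0.
have ltS' : #|S'| < n + c.
  have : f (att v0) \in low by apply/fU/attX/(subsetP CL).
  rewrite inE => /(leq_ltn_trans _); apply; apply/subset_leq_card/subsetP=> s sS'.
  by rewrite in_nbh inE blue.
have cCL := subset_leq_card CL.
(* [S'] is part of the blue neighbourhood of a vertex of [low], hence smaller than [n + c]. This
   forces [C] to be large, so that [P] has pages for [t] books. *)
have xC : x <= #|C| by have := card_W; lia.
have nm : ~ matching B t S'.
  move=> mS; apply: no_books; apply: (@packs_sub _ _ _ _ (S' :|: P)) (subsetT _) _.
  apply: pack_pool mS _.
    apply/pred0P=> s /=; apply/negbTE/negP=> /andP[]; rewrite inE => /andP[_].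
    by rewrite inE => /negP + /PX.
  move=> u v uS vS _; apply: leq_trans (_ : #|P| <= _); first by rewrite cP.
  by apply/subset_leq_card/subsetP=> p pP; rewrite !inE pP ![adj B _ p]adj_sym !blue.
have [A [AS cA degA]] := no_matching t_gt0 nm.
have nA : n <= #|A| by have := card_W; lia.
(* The leaves left out number at least [4 * t - 3], which covers the cost [2 * (2 * t - 2)] of
   minimum degree 2. *)
have [|||f2 f2emb] := @near_clique _ _ B G X A (2 * t - 2) q _ degA.
- by have := n_gt0; lia.
- by apply: leq_trans deg_G; apply: degsumS; apply: subsetT.
- move=> j e /andP[_ jX] ej jq; have [|e2|] := @few_large_degrees (2 * t - 2) _ j e ej jq.
  + by lia.
  + have : (2 * t - 2) * e <= (2 * t - 2) * 2 by rewrite leq_mul2l e2 orbT.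
    by move: ((2 * t - 2) * e) => de; lia.
  + by have := n_gt0; move: ((2 * t - 2) * e) => de; lia.
set F := A :\: f2 @: X.
have cF : #|L| <= #|F|.
  have := cardsID (f2 @: X) A; have := subset_leq_card (subsetIr A (f2 @: X)).
  by rewrite (card_emb f2emb) -/F; lia.
have [f2i f2A f2e] := f2emb.
have Fneq v s : v \in L -> s \in F -> f2 (att v) != s.
  move=> vL; rewrite inE => /andP[sX _]; apply: contraNneq sX => <-.
  by apply: imset_f; apply: attX.
have [|f3 f3emb] := attach_leaves leafL f2emb (subxx _); last first.
- exact: (no_red (is_embS (subxx _) (subsetT _) f3emb)).
rewrite -/X -/F => C2 C2L.
have cC2 := subset_leq_card C2L.
case: (set_0Vmem C2) => [->|[v vC2]]; first by rewrite cards0.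
have vL := subsetP C2L v vC2.
(* For a small [C2] the red neighbours of one attachment suffice; a large [C2] reaches all of [F],
   since a vertex of [A] has at most [2 * t - 2] blue neighbours in [A]. *)
case: (leqP (#|C2| + (2 * t - 2)) #|L|) => le.
  apply: leq_trans (_ : #|F :\: nbh B A (f2 (att v))| <= _).
    have := cardsID (nbh B A (f2 (att v))) F; have := subset_leq_card (subsetIr F (nbh B A (f2 (att v)))).
    by have := degA _ (f2A _ (attX v vL)); lia.
  apply/subset_leq_card/subsetP=> s; rewrite in_setD => /andP[sN sF].
  rewrite inE; apply/exists_inP; exists v; rewrite // sF /= /compl_rel /= Fneq //=.
  by apply: contra sN => h; rewrite in_nbh h andbT; move: sF; rewrite inE => /andP[].
apply: leq_trans (_ : #|F| <= _); first by lia.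
apply/subset_leq_card/subsetP=> s sF; rewrite inE; apply: contraT => /exists_inPn none.
have : (fun v => f2 (att v)) @: C2 \subset nbh B A s.
  apply/subsetP=> ? /imsetP[u uC2 ->]; have uL := subsetP C2L u uC2.
  have := none u uC2; rewrite sF /= /compl_rel /= Fneq //= negbK adj_sym in_nbh => ->.
  by rewrite andbT; apply/f2A/attX.
move/subset_leq_card; rewrite card_in_imset; last first.
  move=> u u' /(subsetP C2L) uL /(subsetP C2L) u'L /f2i e.
  by apply: att_inj => //; apply: e; apply: attX.
by have := degA s; move: sF; rewrite inE => /andP[_ sA] /(_ sA); lia.
Qed.

(** Shortening the path [i] times brings the order down to [n - c], where [embed_sparse] applies;
    [path_step] then restores the vertices one by one. *)
Lemma embed_long_path i (G' : sgraph V) X ys : conn G' X ->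
  suspended G' X ys -> 3 * x + 5 * t + i <= size ys + 4 ->
  degsum G' X <= 2 * #|X| + 2 * l -> #|X| <= n -> #|X| + c <= n + i ->
  exists f, is_emb (compl B) G' X setT f.
Proof.
elim: i G' X ys => [|i IH] G' X ys cX S szys degX Xn Xi.
  have [||f femb] := embed_sparse card_low _ cX degX; first by move=> p; rewrite inE.
    by rewrite addn0 in Xi.
  by exists f; apply: is_embS femb => //; apply: subsetT.
have tx := tx; have x0 := x_gt0.
have [|a [b [d [rest eys]]]] := suspended_size3 S; first by lia.
rewrite {}eys in S szys.
have bX : b \in X by have [_ sub' _ _] := S; apply: sub'; rewrite !inE eqxx orbT.
have cXb := cardsD1 b X; rewrite bX in cXb.
have dS := degsum_short S.
have [||||f femb] := IH (short G' a d) (X :\ b) [:: a, d & rest] (conn_short S cX) (suspended_short S).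
- by move: szys => /=; lia.
- by lia.
- by lia.
- by lia.
apply: (@path_step _ _ B G' X a b d rest setT f n q k t) => //.
- by move: szys; rewrite -/x /=; lia.
- by move: szys; rewrite -/x /=; lia.
- by rewrite /q; lia.
- by rewrite cardsT; have := card_W; lia.
- move=> j e ej jq; have [|e2|] := @few_large_degrees (2 * t - 2) _ j e ej jq; first by lia.
    by left.
  by have := n_gt0; move: (_ * e) => de; lia.
Qed.

(** * Many leaves at one vertex *)

Section Star.
Variables (L : {set V}) (w : V).
Hypothesis leafL : forall v, v \in L -> is_leaf v /\ att v = w.
Hypothesis wL : w \notin L.
Hypothesis card_L : 24 * x <= #|L|.

Lemma leafL' v : v \in L -> is_leaf v /\ att v \notin L.
Proof. by move=> /leafL[-> ->]. Qed.

Lemma card_core : #|setT :\: L| + #|L| = n.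
Proof. by have := cardsID L setT; rewrite (setIidPr (subsetT L)) cardsT card_V addnC. Qed.

(* Otherwise the image of [w] has enough red neighbours for the leaves. *)
Lemma star_center f : is_emb (compl B) G (setT :\: L) setT f ->
  n + t <= #|nbh B setT (f w)| + 1.
Proof.
move=> femb; rewrite leqNgt; apply/negP => lt.
have cX := card_core; set X := setT :\: L in cX femb *.
pose S := ~: (f @: X).
have cS : #|S| + #|X| = #|W|.
  by have := cardsC (f @: X); rewrite (card_emb femb) -/S; lia.
have [|C CL|f' f'emb] := @attach_leaves L setT S f leafL' femb; last exact: no_red f'emb.
  by rewrite setTD.
case: (set_0Vmem C) => [->|[v vC]]; first by rewrite cards0.
have vL := subsetP CL v vC; have [_ av] := leafL vL.
apply: leq_trans (_ : #|S :\: nbh B setT (f w)| <= _).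
  have := subset_leq_card CL; have := card_W.
  have := cardsID (nbh B setT (f w)) S; have := subset_leq_card (subsetIr S (nbh B setT (f w))).
  lia.
apply/subset_leq_card/subsetP=> s; rewrite in_setD in_nbh in_setT /= => /andP[sN sS].
rewrite inE; apply/exists_inP; exists v; rewrite // av sS /= /compl_rel /= sN andbT.
move: sS; rewrite inE; apply: contraNneq => <-; apply: imset_f.
by rewrite !inE wL.
Qed.

(** Without [L], the graph has at most [n - 24 * x] vertices and fits greedily into [A] with [w]
    placed at [z]; then [star_center] applies to [z]. Here [d + g = 7 * x]. *)
Lemma high_degree (A : {set W}) z : n <= #|A| + 12 * x ->
  (forall a, a \in A -> #|nbh B A a| <= 2 * x - 2) -> #|nbh B A z| <= 7 * x ->
  n + t <= #|nbh B setT z| + 1.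
Proof.
move=> cA degA degz; have x0 := x_gt0; have n111 := n_111; have cX := card_core.
have [||||f [fw _ femb]] := @near_clique_root _ _ B G (setT :\: L) w A z (2 * x - 2) (5 * x + 2) q _ degA.
- by rewrite !inE wL.
- by apply: leq_trans degz _; lia.
- by apply: leq_trans deg_G; apply: degsumS; apply: subsetT.
- move=> j e /andP[_ jX] ej jq.
  have cAz : #|A| <= #|A :\ z| + 1 by rewrite (cardsD1 z A); case: (z \in A) => /=; lia.
  have [||] := @few_large_degrees (2 * x - 2) _ j e ej jq; first by [].
    move=> e2; have : (2 * x - 2) * e <= (2 * x - 2) * 2 by rewrite leq_mul2l e2 orbT.
    by move: ((2 * x - 2) * e) => de; lia.
  by move: ((2 * x - 2) * e) => de; lia.
by rewrite -fw; apply: star_center.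
Qed.

Lemma card_nbh_split (A C : {set W}) z :
  #|nbh B A z| <= #|nbh B C z| + #|A :\: C|.
Proof.
have : nbh B A z \subset nbh B C z :|: (A :\: C).
  apply/subsetP=> y; rewrite in_setU !in_nbh !inE => /andP[-> ->].
  by case: (y \in C).
by move/subset_leq_card; rewrite cardsU; lia.
Qed.

Lemma card_inter_ge (P : {set W}) (M N : {set W}) m1 m2 : M \subset P -> N \subset P ->
  #|P| <= #|M| + m1 -> #|P| <= #|N| + m2 -> #|P| <= #|M :&: N| + (m1 + m2).
Proof.
move=> MP NP c1 c2; have := cardsU M N.
have : #|M :|: N| <= #|P| by apply: subset_leq_card; rewrite subUset MP.
have := subset_leq_card (subsetIl M N); lia.
Qed.

(** Two vertices of [S] together miss at most [2 * m] vertices of [P], so they share the [x = t * k]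
    pages that [pack_pool] asks for. *)
Lemma pool_no_matching (S P : {set W}) m : [disjoint S & P] -> matching B t S ->
  (forall u, u \in S -> #|P| <= #|nbh B P u| + m) -> x + 2 * m <= #|P| -> False.
Proof.
move=> dSP mS hm cP; apply: no_books.
apply: (@packs_sub _ _ _ _ (S :|: P)) (subsetT _) _; apply: pack_pool dSP mS _.
move=> u v uS vS _; rewrite -/x.
have := card_inter_ge (nbh_sub B P u) (nbh_sub B P v) (hm u uS) (hm v vS); lia.
Qed.

(** If fewer than [t] vertices had blue degree at least [n + t - 1], the core could be embedded off
    them, against [star_center]. So [star_free_nbh] applies to such vertices. *)
Lemma first_clique : exists A : {set W},
  [/\ n <= #|A| + 2 * x, #|A| < n + 2 * k.-1 + 1 & forall a, a \in A -> #|nbh B A a| < k].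
Proof.
pose Y := [set p | n + t <= #|nbh B setT p| + 1].
have [tc c4] := c_bounds.
have tY : t <= #|Y|.
  rewrite leqNgt; apply/negP => lt.
  have := cardsC Y => eW.
  have [|||f femb] := @embed_without_leaves L (~: Y) leafL'.
  - by have := card_L; lia.
  - by have := card_W; lia.
  - by move=> p; rewrite !inE -ltnNge; lia.
  have [_ fY _] := femb; have := star_center (is_embS (subxx _) (subsetT _) femb).
  have := fY w; rewrite !inE wL => /(_ isT); lia.
have [p [U [pY cU degA]]] := star_free_nbh tY.
exists (nbh B setT p :\: U); split=> //.
- have := cardsID U (nbh B setT p); have := subset_leq_card (subsetIr (nbh B setT p) U).
  have := seedsE; have := tkx; have := tx; have := x_gt0.
  by move: pY cU; rewrite inE; move: (t.-1 * k.+2) => a; lia.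
(* A larger set would host all of [G] by [embed_large]. *)
- rewrite addn1 ltnS leqNgt; apply/negP => lt.
  have [||f femb] := @embed_large V G setT _ _ deg_G _ degA.
  + by rewrite cardsT card_V.
  + by apply: ltnW.
  exact: (no_red (is_embS (subxx _) (subsetT _) femb)).
Qed.
Lemma card_nbh_cover (A C D : {set W}) z : A \subset C :|: D ->
  #|nbh B A z| <= #|nbh B C z| + #|nbh B D z|.
Proof.
move=> /subsetP ACD; have : nbh B A z \subset nbh B C z :|: nbh B D z.
  apply/subsetP=> y; rewrite in_setU !in_nbh => /andP[/ACD + ->].
  by rewrite in_setU !andbT.
by move/subset_leq_card; rewrite cardsU; lia.
Qed.

Lemma card_non_nbh (A : {set W}) y :
  #|A :\: nbh B A y| = \sum_(a in A) ~~ adj B y a.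
Proof.
rewrite -sum1_card (eq_bigl (fun a => (a \in A) && ~~ adj B y a)).
  by rewrite big_mkcondr /=; apply: eq_bigr => a _; case: adj.
by move=> a; rewrite in_setD in_nbh; case: (a \in A); rewrite ?andbF ?andbT.
Qed.

(** By [high_degree], vertices of [A] are blue to nearly everything outside. Hence most outside
    vertices are blue to two thirds of [A]; any two of these share a third of [A], so they span no
    [t] disjoint blue edges and contain a near red clique [C]. *)
Lemma second_clique (A : {set W}) :
  n <= #|A| + 2 * x -> #|A| < n + 2 * k.-1 + 1 ->
  (forall a, a \in A -> #|nbh B A a| < k) ->
  exists C : {set W}, [/\ [disjoint A & C], n <= #|C| + 12 * x,
    forall y, y \in C -> 3 * #|A :\: nbh B A y| <= #|A|,
    forall y, y \in C -> #|nbh B C y| <= 2 * t - 2 &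
    forall a, a \in A -> #|C| <= #|nbh B C a| + 3 * x].
Proof.
move=> lA uA degA; have x0 := x_gt0; have n111 := n_111; have kx := kx; have tx := tx.
have cW := card_W; have cAC := cardsC A.
have degA' a : a \in A -> #|nbh B A a| <= 2 * x - 2 by move/degA; lia.
have redC a : a \in A -> #|~: A| <= #|nbh B (~: A) a| + 3 * x.
  move=> aA; have : n + t <= #|nbh B setT a| + 1.
    by apply: high_degree degA' _; [lia|have := degA a aA; lia].
  have : [set: W] \subset ~: A :|: A by rewrite setUC setUCr.
  by move/(@card_nbh_cover _ _ _ a); have := degA a aA; lia.
pose bad := [set y in ~: A | #|A| < 3 * #|A :\: nbh B A y|].
(* Red pairs between [A] and its complement are counted twice: at most [3 * x] at each vertex of
   [A], more than [#|A| / 3] at each bad vertex. *)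
have cbad : #|bad| <= 9 * x.
  have A0 : 0 < #|A| by lia.
  rewrite -(leq_pmul2r A0).
  have h1 : #|bad| * #|A| <= \sum_(y in bad) 3 * #|A :\: nbh B A y|.
    by rewrite -sum_nat_const; apply: leq_sum => y; rewrite inE => /andP[_ /ltnW].
  have h2 : \sum_(y in bad) 3 * #|A :\: nbh B A y| <= \sum_(y in ~: A) 3 * #|A :\: nbh B A y|.
    rewrite [leqRHS](big_setID bad) /= (setIidPr _) ?leq_addr //.
    by apply/subsetP=> y; rewrite !inE => /andP[].
  have h3 : \sum_(y in ~: A) #|A :\: nbh B A y| = \sum_(a in A) #|~: A :\: nbh B (~: A) a|.
    under eq_bigr => y _ do rewrite card_non_nbh.
    under [RHS]eq_bigr => a _ do rewrite card_non_nbh.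
    rewrite exchange_big; apply: eq_bigr => a _; apply: eq_bigr => y _.
    by rewrite adj_sym.
  have h4 : \sum_(a in A) #|~: A :\: nbh B (~: A) a| <= #|A| * (3 * x).
    rewrite -sum_nat_const; apply: leq_sum => a /redC.
    have := cardsID (nbh B (~: A) a) (~: A); rewrite (setIidPr (nbh_sub _ _ _)); lia.
  move: h2; rewrite -!big_distrr /= h3 => h2.
  apply: leq_trans h1 (leq_trans _ (_ : 3 * (#|A| * (3 * x)) <= _)).
    by rewrite -big_distrr /=; apply: leq_trans h2 _; rewrite leq_mul2l h4 orbT.
  by lia.
have bad_sub : bad \subset ~: A by apply/subsetP=> y; rewrite inE => /andP[].
have good y : y \in ~: A :\: bad -> 3 * #|A :\: nbh B A y| <= #|A|.
  by rewrite in_setD inE => /andP[+ yA]; rewrite yA /= -leqNgt.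
have nm : ~ matching B t (~: A :\: bad).
  move=> mC; apply: (@pool_no_matching _ A (#|A| %/ 3) _ mC).
  - by apply/pred0P=> y /=; rewrite !inE; case: (y \in A); rewrite ?andbF.
  - move=> u /good; have := cardsID (nbh B A u) A; rewrite (setIidPr (nbh_sub _ _ _)); lia.
  - by lia.
have [C [CS cC degC]] := no_matching t_gt0 nm.
have cS := cardsID bad (~: A); rewrite (setIidPr bad_sub) in cS.
have CA : C \subset ~: A by apply: subset_trans CS (subsetDl _ _).
exists C; split=> //.
- by rewrite disjoint_sym disjoints_subset.
- by lia.
- by move=> y /(subsetP CS); apply: good.
move=> a aA; have := redC a aA.
have : #|nbh B (~: A) a| <= #|nbh B C a| + #|~: A :\: C| by apply: card_nbh_split.
have := cardsID C (~: A); rewrite (setIidPr CA); lia.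
Qed.

(** The two near cliques are extended to [A] and [C], each with a vertex having no blue neighbour in
    its own class. A degree count then leaves at least [t] vertices in [R], each the seed of a blue
    book. *)
Lemma no_star : False.
Proof.
have [A0 [lA uA degA]] := first_clique.
have [C0 [dAC lC redC degC redA]] := second_clique lA uA degA.
have x0 := x_gt0; have n111 := n_111; have kx := kx; have tx := tx; have cW := card_W.
have degA' a : a \in A0 -> #|nbh B A0 a| <= 2 * x - 2 by move/degA; lia.
have degC' a : a \in C0 -> #|nbh B C0 a| <= 2 * x - 2 by move/degC; lia.
have A0C0 y : y \in A0 -> y \notin C0.
  by move=> yA; apply/negP=> yC; have /pred0P/(_ y)/= := dAC; rewrite yA yC.
(* All vertices are sorted by their blue degrees into the two near cliques; those of [R] have many
   blue neighbours in both. *)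
pose A := [set y | #|nbh B A0 y| <= 7 * x].
pose C := [set y | (7 * x < #|nbh B A0 y|) && (#|nbh B C0 y| <= 7 * x)].
pose R := [set y | (7 * x < #|nbh B A0 y|) && (7 * x < #|nbh B C0 y|)].
have hiA y : y \in A -> n + t <= #|nbh B setT y| + 1.
  by rewrite inE; apply: high_degree degA'; lia.
have hiC y : y \in C -> n + t <= #|nbh B setT y| + 1.
  by rewrite inE => /andP[_]; apply: high_degree degC'; lia.
have A0A : A0 \subset A by apply/subsetP=> y /degA; rewrite inE; lia.
have C0C : C0 \subset C.
  apply/subsetP=> y yC; rewrite inE; have := degC y yC; have := redC y yC.
  have := cardsID (nbh B A0 y) A0; rewrite (setIidPr (nbh_sub _ _ _)); lia.
pose rest := ~: (A0 :|: C0).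
have crest : #|rest| + #|A0| + #|C0| = #|W|.
  have := cardsC (A0 :|: C0); rewrite -/rest; have := cardsU A0 C0.
  by move: dAC; rewrite -setI_eq0 => /eqP->; rewrite cards0; lia.
have split3 y : #|nbh B setT y| <= #|nbh B A0 y| + #|nbh B C0 y| + #|rest|.
  have : [set: W] \subset (A0 :|: C0) :|: rest by rewrite setUCr.
  move/(@card_nbh_cover _ _ _ y); have := @card_nbh_cover (A0 :|: C0) A0 C0 y (subxx _).
  by have := subset_leq_card (nbh_sub B rest y); lia.
have toC y : y \in A -> #|C0| <= #|nbh B C0 y| + 9 * x.
  by move=> yA; have := hiA y yA; have := split3 y; move: yA; rewrite inE; lia.
have toA y : y \in C -> #|A0| <= #|nbh B A0 y| + 19 * x.
  by move=> yC; have := hiC y yC; have := split3 y; move: yC; rewrite inE => /andP[_]; lia.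
have small m : m <= 22 * x -> 2 * t.-1 * m.+1 + 12 * x < n.
  move=> lm; apply: leq_ltn_trans (_ : 2 * x.-1 * (22 * x).+1 + 12 * x < n).
    by rewrite leq_add2r leq_mul //; lia.
  apply: leq_trans n_large; have := x0; clear; case: (x) => // y _ /=; nia.
have smallA : 12 * x <= n by lia.
have noneA : exists2 y, y \in A & nbh B A y = set0.
  apply: NNPP => none; have mA : matching B t (A :\: set0).
    (* The bound [22 * x] consists of [7 * x] into [A0] and at most [15 * x] into the vertices
       outside [A0] and [C0]. *)
    apply: (@matching_min_degree _ _ _ (22 * x)) => [y yA|].
      apply/andP; split.
        by rewrite lt0n cards_eq0; apply/eqP=> e; apply: none; exists y.
      have : A \subset A0 :|: rest.
        apply/subsetP=> z zA; rewrite !inE; case: (z \in A0) => //=.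
        by apply: contraL zA => /(subsetP C0C); rewrite !inE -ltnNge => /andP[].
      move/(@card_nbh_cover _ _ _ y); have := subset_leq_card (nbh_sub B rest y).
      by move: yA; rewrite inE; lia.
    rewrite cards0 add0n; have := subset_leq_card A0A; have := small _ (leqnn _).
    by move: (_ * _.+1) => m; lia.
  rewrite setD0 in mA; apply: pool_no_matching mA toC _; last by lia.
  apply/pred0P=> z /=; apply/negbTE/negP=> /andP[+ /(subsetP C0C)].
  by rewrite !inE leqNgt => /negP h /andP[].
have noneC : exists2 y, y \in C & nbh B C y = set0.
  apply: NNPP => none; have mC : matching B t (C :\: set0).
    apply: (@matching_min_degree _ _ _ (22 * x)) => [y yC|].
      apply/andP; split.
        by rewrite lt0n cards_eq0; apply/eqP=> e; apply: none; exists y.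
      have : C \subset C0 :|: rest.
        apply/subsetP=> z zC; rewrite !inE; case: (z \in C0) => //=.
        rewrite orbF; apply: contraL zC => /(subsetP A0A).
        by rewrite !inE leqNgt => /negbTE->.
      move/(@card_nbh_cover _ _ _ y); have := subset_leq_card (nbh_sub B rest y).
      by move: yC; rewrite inE => /andP[_]; lia.
    rewrite cards0 add0n; have := subset_leq_card C0C; have := small _ (leqnn _).
    by move: (_ * _.+1) => m; lia.
  rewrite setD0 in mC; apply: pool_no_matching mC toA _; last by lia.
  apply/pred0P=> z /=; apply/negbTE/negP=> /andP[+ /(subsetP A0A)].
  by rewrite !inE => /andP[h _]; rewrite leqNgt h.
(* A vertex with no blue neighbour in [A] has at least [n + t - 1] outside [A]; likewise for [C].
   The two complements cover all [2 * n + t - 2] vertices and meet in [R]. *)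
have tR : t <= #|R|.
  have [a aA na] := noneA; have [b bC nb] := noneC.
  have ha : #|nbh B setT a| <= #|~: A|.
    apply/subset_leq_card/subsetP=> z; rewrite in_nbh in_setT /= in_setC => az.
    by apply/negP=> zA; have := in_set0 z; rewrite -na in_nbh zA az.
  have hb : #|nbh B setT b| <= #|~: C|.
    apply/subset_leq_card/subsetP=> z; rewrite in_nbh in_setT /= in_setC => bz.
    by apply/negP=> zC; have := in_set0 z; rewrite -nb in_nbh zC bz.
  have eR : R = ~: A :&: ~: C.
    by apply/setP=> z; rewrite !inE -ltnNge; case: (ltnP _ (#|nbh B A0 z|)); rewrite //= -ltnNge.
  have eT : ~: A :|: ~: C = setT.
    by apply/setP=> z; rewrite !inE -ltnNge; case: (ltnP _ (#|nbh B A0 z|)).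
  have := cardsUI (~: A) (~: C); rewrite -eR eT cardsT.
  by have := hiA a aA; have := hiC b bC; lia.
have [R' R'R cR'] := subset_card_exists tR.
apply: no_books; rewrite -setC0; apply: (pack_seeds cR').
  by rewrite disjoint_sym disjoints_subset sub0set.
rewrite cards0 add0n => p U pR cU.
have cU' : #|U| + k + 2 <= 3 * x by have := seedsE; lia.
have := subsetP R'R p pR; rewrite inE => /andP[pA pC].
have [a] : exists a, a \in nbh B A0 p :\: U.
  apply/card_gt0P; have := cardsID U (nbh B A0 p).
  by have := subset_leq_card (subsetIr (nbh B A0 p) U); lia.
rewrite in_setD in_nbh => /and3P[aU aA pa].
(* The spine joins [p] to [a] in [A0]. In [C0], [p] has more than [7 * x] blue neighbours and [a]
   misses at most [3 * x], so enough pages survive the deletion of [U]. *)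
have [|y|S [bS pS aS SK]] := @book_intro _ B k p a ((nbh B C0 p :&: nbh B C0 a) :\: U) pa.
- have := cardsID U (nbh B C0 p :&: nbh B C0 a).
  have := subset_leq_card (subsetIr (nbh B C0 p :&: nbh B C0 a) U).
  have ip : #|C0| <= #|nbh B C0 p| + (#|C0| - #|nbh B C0 p|) by rewrite -leq_subLR.
  have := card_inter_ge (nbh_sub B C0 p) (nbh_sub B C0 a) ip (redA a aA).
  by have := subset_leq_card (nbh_sub B C0 p); lia.
- by rewrite !inE => /andP[_ /andP[/andP[_ ->] /andP[_ ->]]].
exists S; split=> //; apply/pred0P=> y /=; apply/negbTE/negP=> /andP[].
rewrite in_setD1 => /andP[yp /(subsetP SK)]; rewrite !in_setU1 (negbTE yp) /=.
by case/orP=> [/eqP->|]; rewrite ?(negbTE aU) // in_setD => /andP[/negP].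
Qed.
End Star.

(** * The three cases for a sparse connected graph *)

Lemma has_neighbour v : exists u, adj G v u.
Proof.
have [||| y [z []]] := conn_G (Y := [set v]); rewrite ?subsetT //.
- by apply/set0Pn; exists v; rewrite inE.
- apply/eqP=> e; have := cardsT V; rewrite -e cards1 card_V.
  by have := n_111; have := x_gt0; lia.
- by rewrite inE => /eqP-> _ _; exists z.
Qed.

(** Two adjacent leaves would form a component of order 2. *)
Lemma att_not_leaf v : is_leaf v -> ~~ is_leaf (att v).
Proof.
move=> lv; apply/negP=> la; have va := adj_att lv.
have ea : att (att v) = v.
  have : v \in nbh G setT (att v) by rewrite in_nbh in_setT adj_sym.
  by rewrite (attP la) inE => /eqP.
have [||| y [z []]] := conn_G (Y := [set v; att v]); rewrite ?subsetT //.
- by apply/set0Pn; exists v; rewrite !inE eqxx.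
- apply/eqP=> e; have := cardsT V; rewrite -e cards2 card_V.
  by have := n_111; have := x_gt0; case: eqP => /=; lia.
- move=> yin _ zn yz; have : z \in nbh G setT y by rewrite in_nbh in_setT.
  move: zn; case/set2P: yin => ->; rewrite ?(attP lv) ?(attP la) ?ea !inE negb_or.
    by case/andP=> _ /negbTE->.
  by case/andP=> /negbTE->.
Qed.

Lemma no_sparse_graph : False.
Proof.
have x0 := x_gt0; have n111 := n_111; have tx := tx.
pose leaves := [set v | is_leaf v]; pose E := att @: leaves.
have leafE v : v \in leaves = is_leaf v by rewrite inE.
case: (leqP (4 * x - 3) #|E|) => [/subset_card_exists[C CE cC]|ltE].
  (* One leaf is selected for each of the distinct attachments. *)
  pose g u := odflt u [pick v in leaves | att v == u].
  have gP u : u \in C -> g u \in leaves /\ att (g u) = u.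
    move=> /(subsetP CE)/imsetP[v vl eu]; rewrite /g; case: pickP => [w /andP[wl /eqP]|/(_ v)] //.
    by rewrite /= vl eu eqxx.
  apply: (@no_leaf_matching (g @: C)).
  - move=> _ /imsetP[u /gP[gl ga] ->]; rewrite leafE in gl; split=> //.
    apply/negP=> /imsetP[u' /gP[gl' _] e]; rewrite leafE -e in gl'.
    by have := att_not_leaf gl; rewrite gl'.
  - by move=> _ _ /imsetP[u /gP[_ ga] ->] /imsetP[u' /gP[_ ga'] ->]; rewrite ga ga' => ->.
  - rewrite card_in_imset ?cC; first by lia.
    by move=> u u' /gP[_ ga] /gP[_ ga'] e; rewrite -ga e ga'.
case: (boolP [exists u in E, 24 * x <= #|[set v in leaves | att v == u]|]).
  case/exists_inP=> u /imsetP[v vl eu] big; rewrite leafE in vl.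
  apply: (@no_star [set v in leaves | att v == u] u) => // [v'|].
    by rewrite inE leafE => /andP[-> /eqP].
  by rewrite inE leafE eu (negbTE (att_not_leaf vl)).
move=> /exists_inPn few.
have cl : #|leaves| <= #|E| * (24 * x).
  have sub : leaves \subset \bigcup_(u in E) [set v in leaves | att v == u].
    apply/subsetP=> v vl; apply/bigcupP; exists (att v); first exact: imset_f.
    by rewrite in_set vl eqxx.
  apply: leq_trans (subset_leq_card sub) (leq_trans (leq_card_bigcup _ _) _).
  by rewrite -sum_nat_const; apply: leq_sum => u /few; rewrite -ltnNge => /ltnW.
set X := setT :\: leaves.
have attX v : v \in leaves -> att v \in X.
  by rewrite !inE andbT => /att_not_leaf.
have cX : #|X| + #|leaves| = n.
  by have := cardsID leaves setT; rewrite (setIidPr (subsetT _)) cardsT card_V addnC.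
have room e : e <= 4 * x - 3 -> (3 * x + 5 * t + c - 5) * (6 * l + 6 * e) < #|X|.
  move=> le; have := path_room le.
  have : #|E| * (24 * x) <= (4 * x - 4) * (24 * x) by rewrite leq_mul2r; apply/orP; right; lia.
  move=> h2 h1; rewrite -(ltn_add2r #|leaves|) cX; apply: leq_ltn_trans h1.
  by rewrite leq_add2l; apply: leq_trans cl h2.
have [z0 z0X] : exists z0, z0 \in X.
  by apply/card_gt0P; apply: leq_ltn_trans (room 0 _).
have connX : conn G X.
  apply: conn_leaves (subsetT _) _ conn_G => v vl; exists (att v); first exact: attX.
  by apply: attP; rewrite -leafE.
have degX : degsum G X <= 2 * #|X| + 2 * l.
  have := @degsum_leaves _ G setT leaves (subsetT _) _; move: deg_G; rewrite /q.
  suff h : forall v, v \in leaves -> exists2 u, u \in setT :\: leaves & adj G v u.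
    by move=> d /(_ h); rewrite -/X; lia.
  by move=> v vl; exists (att v); [apply: attX|apply: adj_att; rewrite -leafE].
have nbhX b : b \notin E -> nbh G X b = nbh G setT b.
  move=> bE; apply/setP=> v; rewrite !in_nbh in_setD in_setT /= andbT.
  case bv : (adj G b v); rewrite ?andbF // andbT; apply: contra bE => vl.
  have lv : is_leaf v by rewrite -leafE.
  have : b \in nbh G setT v by rewrite in_nbh in_setT adj_sym.
  by rewrite (attP lv) inE => /eqP->; apply: imset_f.
(* Attachments are exceptional, so interior vertices of the path have degree 2 in [G] and not only
   in [X]. The vertex [z0] keeps the exceptional set nonempty when there are no leaves. *)
have [||||ys [un sy sub so hint]] := @long_path _ G X (z0 |: E) l (3 * x + 5 * t + c - 6) connX _ _ _ degX.
- rewrite subUset sub1set z0X; apply/subsetP=> _ /imsetP[v vl ->]; exact: attX.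
- by apply/set0Pn; exists z0; rewrite !inE eqxx.
- move=> v; rewrite in_setU1 negb_or in_setD in_setT andbT leafE => lv /andP[_ vE].
  rewrite nbhX //; move: lv; rewrite /is_leaf.
  have [u vu] := has_neighbour v; have : 0 < #|nbh G setT v|.
    by apply/card_gt0P; exists u; rewrite in_nbh in_setT.
  by case: #|_| => [|[]].
- rewrite (_ : (3 * x + 5 * t + c - 6).+1 = 3 * x + 5 * t + c - 5); last by lia.
  apply: room; rewrite cardsU1; case: (_ \notin _) => /=; lia.
have S : suspended G setT ys.
  apply: suspended_deg2 => // [v _|s1 a b d s2 /hint[+ <-]]; first by rewrite in_setT.
  by rewrite in_setU1 negb_or => /andP[_ /nbhX->].
(* The path has [3 * x + 5 * t + c - 4] vertices, exactly enough for [c] shortenings. *)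
have [||||f femb] := embed_long_path (i := c) conn_G S; last exact: no_red femb.
- by rewrite sy; lia.
- by rewrite cardsT card_V.
- by rewrite cardsT card_V.
- by rewrite cardsT card_V.
Qed.
End Final.
End UpperBound.

(** * The lower bound and the theorem *)

Import Order.TTheory GRing.Theory Num.Theory.

(** A vertex set that no edge leaves is closed under [connect]. *)
Lemma connected_conn (V : finType) (G : sgraph V) : connected G -> conn G setT.
Proof.
move=> [_ cG] Y _ /set0Pn[y yY] YT; apply: NNPP => none.
case/eqP: YT; apply/setP=> z; rewrite in_setT.
have clY : closed (adj G) (mem Y).
  apply: intro_closed => [|u v uv uY]; first by apply: sym_connect_sym; apply: adj_sym.
  by apply: contraT => vY; case: none; exists u, v.
by have := closed_connect clY (cG y z); rewrite /= yY => <-.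
Qed.

(** The degree sum counts ordered adjacent pairs, at most two of which give the same edge. *)
Lemma degsum_edges (V : finType) (G : sgraph V) : degsum G setT <= 2 * #|edges G|.
Proof.
pose P := [set p : V * V | adj G p.1 p.2].
have -> : degsum G setT = #|P|.
  rewrite /degsum -sum1_card (eq_bigl (fun p : V * V => adj G p.1 p.2)); last first.
    by move=> p; rewrite inE.
  rewrite -(pair_big_dep predT (fun u v => adj G u v) (fun _ _ => 1)) /=.
  apply: eq_big => [v|v _]; rewrite ?inE // -sum1_card; apply: eq_bigl => u.
  by rewrite in_nbh in_setT.
have sub : P \subset \bigcup_(e in edges G) [set p in P | [set p.1; p.2] == e].
  apply/subsetP=> p; rewrite inE => pP; apply/bigcupP; exists [set p.1; p.2].
    by apply/imsetP; exists p; rewrite ?inE.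
  by rewrite !inE pP eqxx.
apply: leq_trans (subset_leq_card sub) (leq_trans (leq_card_bigcup _ _) _).
rewrite mulnC -sum_nat_const; apply: leq_sum => _ /imsetP[[a b] /= ab ->].
apply: leq_trans (_ : #|[set (a, b); (b, a)]| <= 2); last by rewrite cards2; case: eqP.
apply/subset_leq_card/subsetP=> -[u v]; rewrite !inE /= => /andP[uv /eqP e].
have nuv : u != v by apply: contraTneq uv => ->; rewrite adj_irr.
have uin : u \in [set a; b] by rewrite -e !inE eqxx.
have vin : v \in [set a; b] by rewrite -e !inE eqxx orbT.
move: uin vin nuv; rewrite !inE !xpair_eqE.
by move=> /orP[/eqP->|/eqP->] /orP[/eqP->|/eqP->]; rewrite ?eqxx ?orbT.
Qed.

Lemma book_map (W : finType) (B : sgraph W) k S (w0 : W) : is_book B k S ->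
  exists h : 'I_2 + 'I_k -> W, [/\ injective h, forall a, h a \in S &
    forall a b, adj (book k) a b -> adj B (h a) (h b)].
Proof.
case=> u [v [uS vS uv cS hS]].
have nuv : u != v by apply: contraTneq uv => ->; rewrite adj_irr.
pose s := enum (S :\ u :\ v).
have sz : size s = k.
  rewrite -cardE; have := cardsD1 v (S :\ u); have := cardsD1 u S.
  by rewrite uS !inE vS eq_sym nuv; lia.
have sP (i : 'I_k) : [/\ nth w0 s i \in S, nth w0 s i != u & nth w0 s i != v].
  have : nth w0 s i \in s by rewrite mem_nth ?sz.
  by rewrite mem_enum !inE => /and3P[-> -> ->].
pose h (a : 'I_2 + 'I_k) := match a with
  | inl i => if i == ord0 then u else v | inr i => nth w0 s i end.
have I2 (i j : 'I_2) : i != ord0 -> j != ord0 -> i = j.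
  by case: i j => [[|[|?]] ?] [[|[|?]] ?] // _ _; apply: val_inj.
exists h; split.
- move=> [i|i] [j|j] /=.
  + case: eqVneq => [->|i0]; case: eqVneq => [->|j0] // e; last by rewrite (I2 i j).
      by rewrite e eqxx in nuv.
    by rewrite e eqxx in nuv.
  + by have [_ ju jv] := sP j; case: ifP => _ e; rewrite e eqxx in ju jv.
  + by have [_ ju jv] := sP i; case: ifP => _ e; rewrite e eqxx in ju jv.
  + by move/eqP; rewrite nth_uniq ?sz ?enum_uniq // => /eqP e; congr inr; apply: val_inj.
- by case=> i /=; [case: ifP|have [] := sP i].
- move=> [i|i] [j|j] /=.
  + rewrite /complete_rel /=; case: (eqVneq i ord0) => [ei|i0]; case: (eqVneq j ord0) => [ej|j0].
    * by rewrite ?ei ?ej ?eqxx.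
    * by [].
    * by rewrite adj_sym.
    * by rewrite (I2 i j i0 j0) eqxx.
  + by have [jS ju jv] := sP j; have [] := hS _ jS ju jv; case: ifP.
  + by have [iS iu iv] := sP i; have [bu bv] := hS _ iS iu iv; move=> _; rewrite adj_sym; case: ifP.
  + by rewrite /compl_rel /= /complete_rel /= andbN.
Qed.

Lemma packs_copies (W : finType) (B : sgraph W) k j (w0 : W) : packs B k j setT ->
  contains_copy (copies j (book k)) B.
Proof.
(* Copies are indexed by [nat], so that the induction can shift the index without casts. *)
suff gen X : packs B k j X -> exists g : nat -> 'I_2 + 'I_k -> W,
    [/\ forall i a, i < j -> g i a \in X,
     forall i i' a b, i < j -> i' < j -> g i a = g i' b -> i = i' /\ a = b &
     forall i a b, i < j -> adj (book k) a b -> adj B (g i a) (g i b)].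
  move/gen=> [g [_ gi ge]]; exists (fun p : 'I_j * ('I_2 + 'I_k) => g p.1 p.2); split.
    move=> [i a] [i' b] /= /(gi i i' a b (ltn_ord i) (ltn_ord i'))[ei ->].
    by congr pair; apply: val_inj.
  by move=> [i a] [i' b] /= /andP[/eqP /= <- ab]; apply: ge.
elim: j X => [|j IH] X /=; first by exists (fun _ _ => w0).
case=> S [bS SX /IH[g [gX gi ge]]]; have [h [hi hS he]] := book_map w0 bS.
exists (fun i => if i is i'.+1 then g i' else h); split.
- by move=> [|i] a lt; [apply: (subsetP SX)|have := gX i a lt; rewrite inE => /andP[]].
- move=> [|i] [|i'] a b lt lt' e.
  + by split=> //; apply: hi.
  + by have := gX i' b lt'; rewrite -e inE hS.
  + by have := gX i a lt; rewrite e inE hS.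
  + by have [-> ->] := gi i i' a b lt lt' e.
- by move=> [|i] a b lt ab; [apply: he|apply: ge].
Qed.

Lemma card_interval M (A : {set 'I_M}) a m :
  (forall i, i \in A -> a <= i < a + m) -> #|A| <= m.
Proof.
move=> hA; rewrite cardE -(size_map val) -(size_iota a m).
apply: uniq_leq_size; first by rewrite map_inj_uniq ?enum_uniq //; apply: val_inj.
by move=> i /mapP[j]; rewrite mem_enum mem_iota => /hA + ->.
Qed.

(* Every blue triangle of this colouring meets the class [A2]. *)
Lemma lower_bound (V : finType) (G : sgraph V) k t n M :
  0 < k -> 0 < t -> 1 < n -> connected G -> #|V| = n -> M + 2 < 2 * n + t ->
  ~ arrows M G (copies t (book k)).
Proof.
move=> k0 t0 n1 cG cV ltM.
pose A0 := [set i : 'I_M | i < n.-1].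
pose A1 := [set i : 'I_M | n.-1 <= i < (2 * n.-1)].
(* Red pairs are those inside [A0] or inside [A1]. Each of these has fewer than [n] vertices, so a
   connected red [G] fits in neither. *)
move/(_ (fun E => (E \subset A0) || (E \subset A1))) => [].
  case=> f [fi fe]; have [V0 con] := cG; have [y0 _] := card_gt0P V0.
  have redP u v : adj G u v -> ((f u \in A0) && (f v \in A0)) || ((f u \in A1) && (f v \in A1)).
    by move/fe => /andP[_]; rewrite eqb_id !subUset !sub1set.
  have dis i : i \in A0 -> i \in A1 -> False by rewrite !inE => h /andP[]; lia.
  have stay (A : {set 'I_M}) : #|A| < n ->
      (forall u v, adj G u v -> f u \in A -> f v \in A) -> f y0 \in A -> False.
    move=> cA step y0A; suff : f @: setT \subset A.
      by move/subset_leq_card; rewrite card_imset // cardsT cV; lia.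
    apply/subsetP=> _ /imsetP[y _ ->].
    have cl : closed (adj G) [pred z | f z \in A].
      by apply: intro_closed => [|u v uv]; [apply: sym_connect_sym; apply: adj_sym|apply: step].
    by have := closed_connect cl (con y0 y); rewrite !inE y0A => <-.
  have [_ [u [_ _ _ y0u]]] : exists y u, [/\ y \in [set y0], u \in setT, u \notin [set y0] & adj G y0 u].
    have [||| y [z [yy zT zn yz]]] := connected_conn cG (Y := [set y0]); rewrite ?subsetT //.
    - by apply/set0Pn; exists y0; rewrite inE.
    - by apply/eqP=> e; have := cardsT V; rewrite -e cards1 cV; lia.
    by exists y, z; split=> //; move: yy yz; rewrite inE => /eqP->.
  case/orP: (redP _ _ y0u) => /andP[y0A _]; move: y0A; apply: stay.
  - by apply: leq_ltn_trans (card_interval (a := 0) (m := n.-1) _) _ => [i|]; rewrite ?inE //; lia.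
  - by move=> a b /redP /orP[/andP[]//|/andP[ha _] /dis/(_ ha)].
  - by apply: leq_ltn_trans (card_interval (a := n.-1) (m := n.-1) _) _ => [i|]; rewrite ?inE; lia.
  - by move=> a b /redP /orP[/andP[ha _] /(dis _ ha)|/andP[]].
case=> f [fi fe].
pose A2 := [set i : 'I_M | 2 * n.-1 <= i].
(* The two spine vertices and one page form a blue triangle, which [A0] and [A1] cannot contain
   between them. *)
have out (i : 'I_t) : exists a, f (i, a) \in A2.
  apply: NNPP => none.
  have cls a : (f (i, a) \in A0) || (f (i, a) \in A1).
    have : f (i, a) \notin A2 by apply/negP=> h; apply: none; exists a.
    by rewrite !inE; lia.
  have blue a b : adj (book k) a b -> ~~ ((f (i, a) \in A0) && (f (i, b) \in A0)) /\
                                     ~~ ((f (i, a) \in A1) && (f (i, b) \in A1)).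
    move=> ab; have /andP[_] := fe (i, a) (i, b) (introT andP (conj (eqxx _) ab)).
    by rewrite eqbF_neg !subUset !sub1set negb_or => /andP.
  have := cls (inl ord0); have := cls (inl ord_max); have := cls (inr (Ordinal k0)).
  have := blue (inl ord0) (inl ord_max) isT.
  have := blue (inl ord0) (inr (Ordinal k0)) isT.
  have := blue (inl ord_max) (inr (Ordinal k0)) isT.
  by do !case: (f _ \in _) => /=; case=> // _ _; case=> // _ _; case.
have [g gP] := fin_all_exists out.
have : #|(fun i => f (i, g i)) @: [set: 'I_t]| <= #|A2|.
  by apply/subset_leq_card/subsetP=> _ /imsetP[i _ ->].
rewrite card_imset ?cardsT ?card_ord; last by move=> i i' /fi[].
have : #|A2| <= M - 2 * n.-1.
  by apply: (card_interval (a := 2 * n.-1)) => i; rewrite inE; have := ltn_ord i; lia.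
lia.
Qed.

Theorem theorem1p10 (k t n : nat) (V : finType) (G : sgraph V)
  (k_gt0 : 0 < k) (t_gt0 : 0 < t)
  (n_large : 111 * t ^ 3 * k ^ 3 <= n)
  (G_connected : connected G)
  (G_order : #|V| = n)
  (G_size : (#|edges G|%:R <=
     n%:R * (1 + 1 / (127 * t%:R ^+ 2 * k%:R ^+ 2 + 79 * t%:R ^+ 2 * k%:R))
     :> rat)%R) :
  ramsey_number_is G (copies t (book k)) (2 * n + t - 2).
Proof.
have n_big : 111 * (t * k * (t * k) * (t * k)) <= n.
  by apply: leq_trans n_large; rewrite !expnS !expn0; clear; lia.
have tk0 : 0 < t * k by rewrite muln_gt0 t_gt0.
have n111 : 111 <= n by apply: leq_trans n_big; rewrite leq_pmulr // !muln_gt0 t_gt0 k_gt0.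
(* The subtraction is truncated, so a tree has [l = 0]. *)
pose l := #|edges G| - n.
have l_small : l * (127 * (t * k * (t * k)) + 79 * (t * k)) <= n.
  (* The denominator of the edge bound; it is at least [127 * x ^ 2 + 79 * x] for [x = t * k]. *)
  pose D := 127 * (t ^ 2 * k ^ 2) + 79 * (t ^ 2 * k).
  have D0 : 0 < D by rewrite addn_gt0 !muln_gt0 t_gt0 k_gt0.
  have lD : l * D <= n.
    case: (leqP #|edges G| n) => le; first by rewrite /l (eqP le).
    have eE : #|edges G| = n + l by rewrite /l subnKC // ltnW.
    move: G_size.
    have -> : (127 * t%:R ^+ 2 * k%:R ^+ 2 + 79 * t%:R ^+ 2 * k%:R = D%:R :> rat)%R.
      by rewrite /D natrD !natrM !expr2 !mulrA.
    rewrite eE natrD mulrDr mulr1 lerD2l mulrA mulr1 ler_pdivlMr ?ltr0n //.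
    by rewrite -natrM ler_nat.
  apply: leq_trans lD; rewrite leq_mul2l; apply/orP; right; rewrite /D.
  by rewrite leq_add ?leq_mul2l //=; [rewrite -!mulnn; lia|rewrite -mulnn -mulnA leq_pmull].
split.
- by lia.
- move=> col; pose B := color_class col false.
  case: (classic (packs B k t setT)) => [pk|np].
    right; have w0 : 'I_(2 * n + t - 2) by exists 0; lia.
    exact: packs_copies w0 pk.
  left; apply: NNPP => none.
  apply: (no_sparse_graph k_gt0 t_gt0 n_big l_small np G_order _ (connected_conn G_connected)).
  + by rewrite card_ord; lia.
  + by have := degsum_edges G; rewrite /l; lia.
  + move=> f [fi _ fe]; apply: none; exists f; split; first by move=> u v; apply: fi.
    move=> u v uv; have /andP[ne] := fe u v (in_setT _) (in_setT _) uv.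
    by rewrite /= /color_rel /= ne /=; case: (col _).
- move=> M M0 arr; rewrite leqNgt; apply/negP=> lt.
  by apply: (lower_bound k_gt0 t_gt0 _ G_connected G_order _ arr); lia.
Qed.
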